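(* Let $(A,\mathfrak{m})$ be a Cohen-Macaulay local ring and let $\mathfrak{a}$ be an $\mathfrak{m}$-primary ideal of $A$. Let $\mathcal{F}=\{\mathfrak{a}_n\}_{n\ge 0}$ be a multiplicative $\mathfrak{a}$-stable filtration. Then $\operatorname{depth}G_{\mathcal{F}^{<m>}}(A)$ is constant for $m\gg 0$.
   Context: All rings are commutative Noetherian. A multiplicative $\mathfrak{a}$-stable filtration is a decreasing sequence $\mathcal{F}=\{\mathfrak{a}_n\}_{n\ge 0}$ of ideals of $A$ such that $\mathfrak{a}_0=A$; $\mathfrak{a}\subseteq\mathfrak{a}_1$ and $\mathfrak{a}_1\ne A$; $\mathfrak{a}_n\mathfrak{a}_m\subseteq\mathfrak{a}_{n+m}$ for all $n,m\ge 0$; and $\mathfrak{a}\mathfrak{a}_n=\mathfrak{a}_{n+1}$ for all $n\gg 0$. $G_{\mathcal{F}}(A)=\bigoplus_{n\ge 0}\mathfrak{a}_n/\mathfrak{a}_{n+1}$ is the associated graded ring of $\mathcal{F}$; it is a finitely generated graded module over $G_{\mathfrak{a}}(A)=\bigoplus_{n\ge 0}\mathfrak{a}^n/\mathfrak{a}^{n+1}$. For $m\ge 1$, $\mathcal{F}^{<m>}=\{\mathfrak{a}_{nm}\}_{n\ge 0}$ (a multiplicative $\mathfrak{a}^m$-stable filtration), so $G_{\mathcal{F}^{<m>}}(A)=\bigoplus_{n\ge 0}\mathfrak{a}_{nm}/\mathfrak{a}_{(n+1)m}$. Depth is taken with respect to the homogeneous maximal ideal of $G_{\mathfrak{a}^m}(A)$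 (equivalently of the Rees algebra $A[\mathfrak{a}^m t]$). *)

(* Defs.v *)
From HB Require Import structures.
From mathcomp Require Import all_boot all_order all_algebra.
From mathcomp Require Import ring_quotient.
From mathcomp Require Import boolp classical_sets.

Set Implicit Arguments.
Unset Strict Implicit.
Unset Printing Implicit Defensive.

Import GRing.Theory.
Local Open Scope classical_set_scope.
Local Open Scope ring_scope.
Local Open Scope quotient_scope.

Section Ideals.
Variable R : comNzRingType.

Definition is_ideal (S : set R) : Prop :=
  [/\ S 0, forall x y, S x -> S y -> S (x + y) & forall a x, S x -> S (a * x)].

(* Unlike [idealr] of MathComp, the unit ideal is allowed. *)
Record ideal := Ideal {
  ideal_set :> R -> Prop;
  ideal_setP : is_ideal ideal_set }.

Implicit Types (I J P : ideal) (S : set R).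

Lemma ideal_setT_subproof : is_ideal setT. Proof. by []. Qed.
Definition unit_ideal := Ideal ideal_setT_subproof.

Lemma ideal_gen_subproof S : is_ideal (smallest is_ideal S).
Proof.
split=> [J [[J0 _ _] _]//|x y Sx Sy J JP|a x Sx J JP].
- by case: (JP) => -[_ JD _] _; apply: JD; [exact: Sx|exact: Sy].
- by case: (JP) => -[_ _ JM] _; apply: JM; exact: Sx.
Qed.
Definition ideal_gen S := Ideal (ideal_gen_subproof S).

Definition ideal_mul I J := ideal_gen [set x * y | x in I & y in J].

Fixpoint ideal_exp I (n : nat) :=
  if n is k.+1 then ideal_mul I (ideal_exp I k) else unit_ideal.

Definition radical I : set R := [set x | exists n : nat, I (x ^+ n)].

Definition proper I : Prop := I <> setT :> set R.

Definition prime_ideal P : Prop :=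
  proper P /\ forall x y, P (x * y) -> P x \/ P y.

Definition maximal_ideal P : Prop :=
  proper P /\ forall J, P `<=` J -> proper J -> J = P :> set R.

Definition primary_ideal I : Prop :=
  proper I /\ forall x y, I (x * y) -> I x \/ radical I y.

(* [I] is P-primary *)
Definition primary_to P I : Prop :=
  primary_ideal I /\ radical I = P :> set R.

Definition noetherian : Prop :=
  forall I, exists s : seq R, I = ideal_gen [set x | x \in s] :> set R.

Definition local_ring (mm : ideal) : Prop :=
  maximal_ideal mm /\ forall P, maximal_ideal P -> P = mm :> set R.

Definition prime_chain (n : nat) (c : nat -> ideal) : Prop :=
  (forall i : nat, (i <= n)%N -> prime_ideal (c i)) /\
  (forall i : nat, (i < n)%N -> c i `<` c i.+1).

Definition has_krull_dim (d : nat) : Prop :=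
  (exists c, prime_chain d c) /\
  (forall n c, prime_chain n c -> (n <= d)%N).

End Ideals.

Arguments ideal_set : simpl never.
Arguments noetherian R : clear implicits.
Arguments has_krull_dim R d : clear implicits.

Section Depth.
Variables (R : comNzRingType) (M : lmodType R).

(* the submodule (x_1, ..., x_k)M *)
Definition seq_mul (x : seq R) : set M :=
  [set v | exists u : nat -> M, v = \sum_(i < size x) x`_i *: u i].

(* The first conjunct says that x_i is a nonzerodivisor on
   M / (x_1, ..., x_(i-1))M, the second that M / (x_1, ..., x_k)M is nonzero. *)
Definition regular_seq (x : seq R) : Prop :=
  (forall i : nat, (i < size x)%N -> forall u : M,
     seq_mul (take i x) (x`_i *: u) -> seq_mul (take i x) u) /\
  seq_mul x <> setT.

(* depth_I(M) = d: the supremum of the lengths of M-regular sequences in I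
   is attained and equals d. *)
Definition has_depth (I : ideal R) (d : nat) : Prop :=
  (exists x : seq R, [/\ {in x, forall a, I a}, regular_seq x & size x = d]) /\
  (forall x : seq R, {in x, forall a, I a} -> regular_seq x -> (size x <= d)%N).

End Depth.

Definition cohen_macaulay_local (R : comNzRingType) (mm : ideal R) : Prop :=
  [/\ noetherian R, local_ring mm &
      exists d : nat, has_krull_dim R d /\ has_depth R^o mm d].

Record filtration (R : comNzRingType) := Filtration {
  fil :> nat -> ideal R;
  fil0 : fil 0%N = setT :> set R;
  fil1_proper : proper (fil 1%N);
  fil_decr : forall n, fil n.+1 `<=` fil n;
  fil_mul : forall n m, ideal_mul (fil n) (fil m) `<=` fil (n + m)%N }.

Record stable_filtration (R : comNzRingType) (I : ideal R) := StableFiltration {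
  sfil :> filtration R;
  sfil_sub : I `<=` sfil 1%N;
  sfil_stable : exists n0 : nat, forall n : nat, (n0 <= n)%N ->
    ideal_mul I (sfil n) = sfil n.+1 :> set R }.

Section IdealFacts.
Variable R : comNzRingType.
Implicit Types (I J K : ideal R).

Lemma ideal_zero I : I 0. Proof. by case: (ideal_setP I). Qed.
Lemma ideal_add I x y : I x -> I y -> I (x + y).
Proof. by case: (ideal_setP I) => _ + _; apply. Qed.
Lemma ideal_mull I a x : I x -> I (a * x).
Proof. by case: (ideal_setP I) => _ _; apply. Qed.
Lemma ideal_opp I x : I x -> I (- x).
Proof. by rewrite -mulN1r; exact: ideal_mull. Qed.
Lemma ideal_sum I (T : Type) (r : seq T) (Q : pred T) (f : T -> R) :
  (forall i, Q i -> I (f i)) -> I (\sum_(i <- r | Q i) f i).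
Proof. by move=> h; apply: big_ind => //; [exact: ideal_zero|exact: ideal_add]. Qed.
Lemma proper1 I : proper I <-> ~ I 1.
Proof.
split=> [h I1|h E]; last by apply: h; rewrite E.
by apply: h; apply/seteqP; split=> // x _; rewrite -[x]mulr1; exact: ideal_mull.
Qed.

Lemma mem_ideal_mul I J x y : I x -> J y -> ideal_mul I J (x * y).
Proof. by move=> Ix Jy; apply: sub_gen_smallest; exists x => //; exists y. Qed.

Lemma ideal_mul_min I J K :
  (forall x y, I x -> J y -> K (x * y)) -> ideal_mul I J `<=` K.
Proof.
move=> h; apply: smallest_sub; first exact: ideal_setP.
by move=> _ [x Ix [y Jy <-]]; exact: h.
Qed.

Lemma ideal_mul_ind I J K a :
  (forall x y, I x -> J y -> K (a * (x * y))) ->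
  forall z, ideal_mul I J z -> K (a * z).
Proof.
move=> h z; pose S : set R := [set w | K (a * w)].
suff : ideal_mul I J `<=` S by apply.
apply: smallest_sub; last by move=> _ [x Ix [y Jy <-]]; exact: h.
split=> [|x y|b x]; rewrite /S /=; first by rewrite mulr0; exact: ideal_zero.
- by rewrite mulrDr; exact: ideal_add.
- by rewrite mulrCA; exact: ideal_mull.
Qed.

Lemma ideal_expD I m n x y :
  ideal_exp I m x -> ideal_exp I n y -> ideal_exp I (m + n) (x * y).
Proof.
elim: m x => [|m IHm] x /= Ix Iy; first exact: ideal_mull.
rewrite mulrC; move: x Ix; apply: ideal_mul_ind => u v Iu Iv.
by rewrite mulrC -mulrA; apply: mem_ideal_mul => //; exact: IHm.
Qed.

Lemma ideal_exp1 I : ideal_exp I 1 = I :> set R.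
Proof.
apply/seteqP; split=> [|x Ix].
  by apply: ideal_mul_min => x y Ix _; rewrite mulrC; exact: ideal_mull.
by rewrite -[x]mulr1; exact: mem_ideal_mul.
Qed.

Lemma fil_mulP (F : filtration R) m n x y : F m x -> F n y -> F (m + n)%N (x * y).
Proof. by move=> Fx Fy; apply: fil_mul; exact: mem_ideal_mul. Qed.

Lemma fil1N1 (F : filtration R) : ~ F 1%N 1.
Proof. exact/proper1/fil1_proper. Qed.

Lemma fil_decrP (F : filtration R) m n : (m <= n)%N -> F n `<=` F m.
Proof.
move=> /subnK <-; elim: (n - m)%N => [|k IHk] //.
by rewrite addSn; apply: subset_trans IHk; exact: fil_decr.
Qed.

Lemma exp_sub_fil I (F : stable_filtration I) m : ideal_exp I m `<=` F m.
Proof.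
elim: m => [|m IHm]; first by rewrite fil0.
apply: ideal_mul_min => x y Ix Iy.
by apply: (@fil_mulP F 1 m); [exact: (@sfil_sub _ _ F)|exact: IHm].
Qed.

Lemma ideal_exp_exp I m n : ideal_exp (ideal_exp I m) n `<=` ideal_exp I (n * m).
Proof.
elim: n => [|n IHn]; first by rewrite mul0n.
rewrite mulSn; apply: ideal_mul_min => x y Ix Iy.
by apply: ideal_expD => //; exact: IHn.
Qed.

End IdealFacts.

Section Adic.
Variables (R : comNzRingType) (I : ideal R) (I_proper : proper I).

Lemma adic0 : ideal_exp I 0 = setT :> set R. Proof. by []. Qed.
Lemma adic1_proper : proper (ideal_exp I 1).
Proof. by rewrite /proper ideal_exp1. Qed.
Lemma adic_decr n : ideal_exp I n.+1 `<=` ideal_exp I n.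
Proof. by apply: ideal_mul_min => x y _; exact: ideal_mull. Qed.
Lemma adic_mul n m :
  ideal_mul (ideal_exp I n) (ideal_exp I m) `<=` ideal_exp I (n + m).
Proof. by apply: ideal_mul_min => x y; exact: ideal_expD. Qed.
Definition adic_filtration := Filtration adic0 adic1_proper adic_decr adic_mul.

Lemma adic_sub : I `<=` adic_filtration 1%N.
Proof. by rewrite /= -[X in X `<=` _]ideal_exp1. Qed.
Lemma adic_stable : exists n0 : nat, forall n : nat, (n0 <= n)%N ->
  ideal_mul I (adic_filtration n) = adic_filtration n.+1 :> set R.
Proof. by exists 0%N. Qed.
Definition adic : stable_filtration I := StableFiltration adic_sub adic_stable.

End Adic.

Section Veronese.
Variables (R : comNzRingType) (I : ideal R) (F : stable_filtration I).
Variables (m : nat) (m_gt0 : (0 < m)%N).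

Lemma veronese0 : F (0 * m)%N = setT :> set R. Proof. exact: fil0. Qed.
Lemma veronese1_proper : proper (F (1 * m)%N).
Proof.
apply/proper1; rewrite mul1n => F1.
by apply: (@fil1N1 _ F); exact: fil_decrP F1.
Qed.
Lemma veronese_decr n : F (n.+1 * m)%N `<=` F (n * m)%N.
Proof. by apply: fil_decrP; rewrite leq_mul2r leqnSn orbT. Qed.
Lemma veronese_mul n k :
  ideal_mul (F (n * m)%N) (F (k * m)%N) `<=` F ((n + k) * m)%N.
Proof. by rewrite mulnDl; exact: fil_mul. Qed.
Definition veronese_filtration : filtration R :=
  @Filtration R (fun n => F (n * m)%N) veronese0 veronese1_proper
    veronese_decr veronese_mul.

Lemma veronese_sub : ideal_exp I m `<=` veronese_filtration 1%N.
Proof. by rewrite /= mul1n; exact: exp_sub_fil. Qed.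
Lemma veronese_stable : exists n0 : nat, forall n : nat, (n0 <= n)%N ->
  ideal_mul (ideal_exp I m) (veronese_filtration n) =
  veronese_filtration n.+1 :> set R.
Proof.
have [n0 hn0] := @sfil_stable _ _ F; exists n0 => n le_n0n.
have {}hn0 k : (n0 <= k)%N -> F (m + k)%N `<=` ideal_mul (ideal_exp I m) (F k).
  move=> le_n0k; elim: (m) => [|j IHj] x.
    by move=> Fx; rewrite -[x]mul1r; exact: mem_ideal_mul.
  have le' : (n0 <= j + k)%N by rewrite (leq_trans le_n0k) ?leq_addl.
  rewrite addSn -(hn0 _ le'); apply: ideal_mul_min => u v Iu /IHj.
  apply: ideal_mul_ind => s t Is Ft.
  by rewrite mulrA; apply: mem_ideal_mul => //; exact: mem_ideal_mul.
apply/seteqP; split; rewrite /= mulSn.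
  by apply: ideal_mul_min => x y /(@exp_sub_fil _ _ F); exact: fil_mulP.
by apply: hn0; rewrite (leq_trans le_n0n) ?leq_pmulr.
Qed.
Definition veronese : stable_filtration (ideal_exp I m) :=
  StableFiltration veronese_sub veronese_stable.

End Veronese.

(* The Rees algebra R(F) is the subring of the polynomials \sum_n c_n t^n
   with c_n \in F n, and G_F(R) = \bigoplus_n F n / F n.+1 is its quotient by the
   ideal of the polynomials with c_n \in F n.+1 for all n; the product of the
   classes of a \in F n and b \in F k is thus the class of a * b in degree
   n + k. *)
Section AssociatedGraded.
Variables (R : comNzRingType) (F : filtration R).

Definition rees_pred : {pred {poly R}} := fun p => `[< forall n, F n p`_n >].

Lemma rees_predP (p : {poly R}) : reflect (forall n, F n p`_n) (p \in rees_pred).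
Proof. exact: asboolP. Qed.

Lemma rees_subring_closed : subring_closed rees_pred.
Proof.
split=> [|p q /rees_predP hp /rees_predP hq|p q /rees_predP hp /rees_predP hq];
  apply/rees_predP => n.
- by rewrite coef1; case: n => [|n] /=; [rewrite fil0|exact: ideal_zero].
- by rewrite coefB; apply: ideal_add => //; exact: ideal_opp.
- rewrite coefM; apply: ideal_sum => i _.
  have := @fil_mulP _ F i (n - i) p`_i q`_(n - i) (hp i) (hq (n - i)%N).
  by rewrite subnKC // -ltnS.
Qed.
HB.instance Definition _ :=
  GRing.isSubringClosed.Build {poly R} rees_pred rees_subring_closed.

Record rees := Rees { rees_val : {poly R}; _ : rees_val \in rees_pred }.
HB.instance Definition _ := [isSub for rees_val].
HB.instance Definition _ := [Choice of rees by <:].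
HB.instance Definition _ := [SubChoice_isSubComNzRing of rees by <:].

Lemma reesP (p : rees) n : F n (val p)`_n.
Proof. by move: n; apply/rees_predP; exact: valP. Qed.

Definition gr_ker : {pred rees} := fun p => `[< forall n, F n.+1 (val p)`_n >].

Lemma gr_kerP (p : rees) : reflect (forall n, F n.+1 (val p)`_n) (p \in gr_ker).
Proof. exact: asboolP. Qed.

Lemma gr_ker_idealr_closed : idealr_closed gr_ker.
Proof.
split=> [||a p q /gr_kerP hp /gr_kerP hq].
- by apply/gr_kerP => n; rewrite rmorph0 coef0; exact: ideal_zero.
- apply/negP => /gr_kerP/(_ 0%N); rewrite rmorph1 coef1.
  exact: fil1N1.
- apply/gr_kerP => n; rewrite rmorphD rmorphM coefD; apply: ideal_add => //.
  rewrite coefM; apply: ideal_sum => i _.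
  have := @fil_mulP _ F i (n - i).+1 _ _ (reesP a i) (hp (n - i)%N).
  by rewrite addnS subnKC // -ltnS.
Qed.
HB.instance Definition _ := isIdealr.Build rees gr_ker gr_ker_idealr_closed.

Definition gr := {ideal_quot gr_ker}.
HB.instance Definition _ := GRing.ComNzRing.on gr.

(* mm / F 1 (+) \bigoplus_(n > 0) F n / F n.+1; for R local with maximal ideal
   mm, this is the homogeneous maximal ideal of G_F(R). *)
Definition gr_max_set (mm : ideal R) : set gr :=
  [set \pi_gr p | p in [set p : rees | mm (val p)`_0]].

Lemma gr_max_is_ideal mm : is_ideal (gr_max_set mm).
Proof.
split=> [|_ _ [p hp <-] [q hq <-]|a _ [p hp <-]].
- exists 0; last by rewrite rmorph0.
  by rewrite /= coef0; exact: ideal_zero.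
- exists (p + q); last by rewrite rmorphD.
  by rewrite /= coefD; exact: ideal_add.
- exists (repr a * p); last by rewrite rmorphM /= reprK.
  by rewrite /= coef0M; exact: ideal_mull.
Qed.
Definition gr_max mm : ideal gr := Ideal (gr_max_is_ideal mm).

End AssociatedGraded.

(* G_F(R) as a module over G_I(R) = gr (adic I), via the ring morphism induced
   by the inclusions I^n <= F n. *)
Section GrModule.
Variables (R : comNzRingType) (I : ideal R) (F : stable_filtration I).

Lemma stable_proper : proper I.
Proof.
apply/proper1 => /(@sfil_sub _ _ F).
exact: fil1N1.
Qed.

Definition gr_adic : comNzRingType := gr (adic stable_proper).

Lemma rees_incl_subproof (p : rees (adic stable_proper)) :
  val p \in rees_pred F.
Proof. by apply/rees_predP => n; apply: exp_sub_fil; exact: reesP. Qed.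
Definition rees_incl (p : rees (adic stable_proper)) : rees F :=
  Rees (rees_incl_subproof p).

Definition gr_map (x : gr_adic) : gr F := \pi_(gr F) (rees_incl (repr x)).

Lemma gr_map_pi p : gr_map (\pi_(gr (adic stable_proper)) p) = \pi_(gr F) (rees_incl p).
Proof.
rewrite /gr_map; apply/eqP; rewrite -Quotient.idealrBE.
have : repr (\pi_(gr (adic stable_proper)) p) - p \in @gr_ker _ (adic stable_proper).
  by rewrite Quotient.idealrBE reprK.
move=> /gr_kerP h; apply/gr_kerP => n.
by have := h n; rewrite !rmorphB; exact: (@exp_sub_fil _ _ F n.+1).
Qed.

Definition gr_mod := gr F.
HB.instance Definition _ := GRing.Zmodule.on gr_mod.

Definition gr_scale (x : gr_adic) (u : gr_mod) : gr_mod :=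
  gr_map x * (u : gr F).

Let gr_mapB : zmod_morphism gr_map.
Proof.
move=> x y; rewrite -[x]reprK -[y]reprK -rmorphB !gr_map_pi -rmorphB.
by congr (\pi_(gr F) _); apply: val_inj.
Qed.
Let gr_mapM : monoid_morphism gr_map.
Proof.
split=> [|x y].
  rewrite -(rmorph1 (\pi_(gr (adic stable_proper)))) gr_map_pi -[RHS](rmorph1 (\pi_(gr F))).
  by congr (\pi_(gr F) _); apply: val_inj.
rewrite -[x]reprK -[y]reprK -rmorphM !gr_map_pi -rmorphM.
by congr (\pi_(gr F) _); apply: val_inj.
Qed.
HB.instance Definition _ := GRing.isZmodMorphism.Build gr_adic (gr F) gr_map gr_mapB.
HB.instance Definition _ := GRing.isMonoidMorphism.Build gr_adic (gr F) gr_map gr_mapM.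

Lemma gr_scaleA x y u : gr_scale x (gr_scale y u) = gr_scale (x * y) u.
Proof. by rewrite /gr_scale mulrA rmorphM. Qed.
Lemma gr_scale1 : left_id 1 gr_scale.
Proof. by move=> u; rewrite /gr_scale rmorph1 mul1r. Qed.
Lemma gr_scaleDr : right_distributive gr_scale +%R.
Proof. by move=> x u v; rewrite /gr_scale mulrDr. Qed.
Lemma gr_scaleDl u : {morph gr_scale^~ u : x y / x + y}.
Proof. by move=> x y; rewrite /gr_scale rmorphD mulrDl. Qed.
HB.instance Definition _ := GRing.Zmodule_isLmodule.Build gr_adic gr_mod
  gr_scaleA gr_scale1 gr_scaleDr gr_scaleDl.

End GrModule.

(* depth of the G_I(R)-module G_F(R) with respect to the homogeneous maximal
   ideal of G_I(R) *)
Definition has_gr_depth (R : comNzRingType) (mm I : ideal R)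
    (F : stable_filtration I) (d : nat) : Prop :=
  @has_depth (gr_adic F) (gr_mod F) (gr_max (adic (stable_proper F)) mm) d.

(* Main.v *)
(* Write [L_n = A / a_n] for [n] in Z, with [a_n = A] for [n <= 0], and let [H^j(L_n)]
   be the degree [n] part of the local cohomology of [L] with respect to the ideal
   generated by the elements [y t], [y] in [a].  The exact sequences
   [0 -> G_n -> L_(n+1) -> L_n -> 0] and the vanishing of every class in degrees
   [n << 0] show that the depth of [G] is at least [k] iff [H^j(L_n) = 0] for all
   [n] and all [j < k]; for [F^<m>] the condition is [H^j(L_(nm)) = 0].
   Conversely, vanishing gives a superficial sequence of length [k], whose initial
   forms are a regular sequence, as long as [k <= depth A].  Let [k <= depth A] be
   maximal such that the condition holds for some [m1].  By induction on [j],
   reducing modulo a superficial element, a class in [H^j(L_n)], [|n| >> 0], that is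
   killed by [a t] is zero.  Hence [H^j(L_n) = 0] for [n >> 0], because classes are
   killed by powers of [a t]; and for [n << 0] a nonzero class would have nonzero
   multiples up to some degree divisible by [m1].  So the condition holds for every
   large [m], the degree [n = 0] being covered by [m1].  Depth greater than
   [k = depth A] is impossible, since one more superficial element would prolong a
   maximal regular sequence of [A]. *)

Require Import Defs.
From mathcomp Require Import all_boot all_order all_algebra.
From mathcomp Require Import ring_quotient.
From mathcomp Require Import boolp classical_sets.
From mathcomp Require Import zify ring.

Set Implicit Arguments.
Unset Strict Implicit.
Unset Printing Implicit Defensive.

Import Order.TTheory GRing.Theory Num.Theory.
Local Open Scope classical_set_scope.
Local Open Scope ring_scope.
Local Open Scope quotient_scope.

(** * Cech cochains in a fixed degree and change of denominators *)

Section Cech.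
Variables (R : comNzRingType) (M : lmodType R) (I : Type) (Y : I -> R).
Implicit Types (f g h : seq I -> M) (s : seq I) (Q : int -> set M).

(* Cech cochains on all tuples, repetitions allowed, with values in the
   localizations of [\bigoplus_n M / Q n] at products of the [Y i] (of degree 1):
   [f : seq I -> M] with parameter [t] is the cochain whose value at [s] is
   [f s / \prod_(i <- s) Y i ^+ t]; in degree [n] and for tuples of size [j] the
   numerators count modulo [Q (n + t * j)].  The recursion is the alternating sum
   over the omitted indices.  [null] allows a common larger denominator. *)
Fixpoint cdiff (t : nat) f s : M :=
  if s is i :: s' then Y i ^+ t *: f s' - cdiff t (fun u => f (i :: u)) s'
  else 0.

Definition cmon (r : nat) s : R := \prod_(i <- s) Y i ^+ r.

Definition cocycle Q (j : nat) (n : int) (t : nat) f : Prop :=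
  forall s, size s = j.+1 -> Q (n + (t * j.+1)%N%:Z) (cdiff t f s).

Definition cobounds Q (j : nat) (n : int) (t : nat) f r g : Prop :=
  forall s, size s = j ->
    Q (n + ((t + r) * j)%N%:Z) (cmon r s *: f s - cdiff (t + r) g s).

Definition null Q (j : nat) (n : int) (t : nat) f : Prop :=
  exists r g, cobounds Q j n t f r g.

(** The complex begins with the empty tuple, whose value lies in [M / Q n] itself, so this is the
    vanishing of local cohomology in degree [n]; for [j = 0] it says that no nonzero class is killed
    by a common power of all the [Y i]. *)
Definition acyclic Q (j : nat) (n : int) : Prop :=
  forall t f, cocycle Q j n t f -> null Q j n t f.

Lemma cdiffB t f g s : cdiff t (fun u => f u - g u) s = cdiff t f s - cdiff t g s.
Proof.
elim: s f g => [|i s IHs] f g /=; first by rewrite subr0.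
by rewrite IHs scalerBr; rewrite !opprD !opprK !addrA; congr (_ + _); rewrite addrAC.
Qed.

Lemma cdiffZ t b f s : cdiff t (fun u => b *: f u) s = b *: cdiff t f s.
Proof.
elim: s f => [|i s IHs] f /=; first by rewrite scaler0.
by rewrite IHs scalerBr !scalerA mulrC.
Qed.

Lemma cdiffD t f g s : cdiff t (fun u => f u + g u) s = cdiff t f s + cdiff t g s.
Proof.
have -> : (fun u => f u + g u) = (fun u => f u - (-1) *: g u).
  by apply/funext => u; rewrite scaleN1r opprK.
by rewrite cdiffB cdiffZ scaleN1r opprK.
Qed.

Lemma cdiffK t f s : cdiff t (cdiff t f) s = 0.
Proof.
elim: s f => [|i s IHs] f //=.
by rewrite cdiffB cdiffZ IHs subr0 subrr.
Qed.

Lemma cmonD r r' s : cmon (r + r') s = cmon r s * cmon r' s.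
Proof. by rewrite /cmon -big_split; apply: eq_bigr => i _; rewrite exprD. Qed.

Lemma cmon_cons r i s : cmon r (i :: s) = Y i ^+ r * cmon r s.
Proof. by rewrite /cmon big_cons. Qed.

Lemma cmon0 s : cmon 0 s = 1.
Proof. by rewrite /cmon big1 // => i _; rewrite expr0. Qed.

Lemma cdiff_cmon t r f s :
  cdiff (t + r) (fun u => cmon r u *: f u) s = cmon r s *: cdiff t f s.
Proof.
elim: s f => [|i s IHs] f /=; first by rewrite scaler0.
under [in X in _ - X]eq_fun do rewrite cmon_cons -scalerA.
rewrite cdiffZ IHs cmon_cons scalerBr !scalerA; congr (_ *: _ - _).
by rewrite exprD; ring.
Qed.

Record graded_family Q : Prop := GradedFamily {
  gfam0 : forall n, Q n 0;
  gfamB : forall n v w, Q n v -> Q n w -> Q n (v - w);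
  gfamZ : forall n b v, Q n v -> Q n (b *: v);
  gfamY : forall n i v, Q n v -> Q (n + 1) (Y i *: v) }.

Section Family.
Variables (Q : int -> set M) (QP : graded_family Q).

Lemma gfamN n v : Q n v -> Q n (- v).
Proof. by move=> ?; rewrite -sub0r; apply: gfamB => //; exact: gfam0. Qed.

Lemma gfamD n v w : Q n v -> Q n w -> Q n (v + w).
Proof. by move=> ? ?; rewrite -[w]opprK; apply: gfamB => //; exact: gfamN. Qed.

Lemma gfamYX n (t : nat) i v : Q n v -> Q (n + t%:Z) (Y i ^+ t *: v).
Proof.
elim: t => [|t IHt] Qv; first by rewrite addr0 expr0 scale1r.
by rewrite exprS -scalerA -addn1 PoszD addrA; apply: gfamY => //; exact: IHt.
Qed.

Lemma gfam_cmon n (r : nat) s v : Q n v -> Q (n + (r * size s)%N%:Z) (cmon r s *: v).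
Proof.
elim: s => [|i s IHs] Qv; first by rewrite muln0 addr0 /cmon big_nil scale1r.
rewrite cmon_cons -scalerA mulnS addnC PoszD addrA; apply: gfamYX; exact: IHs.
Qed.

Lemma gfam_cdiff n t f j s : (forall u, size u = j -> Q n (f u)) ->
  size s = j.+1 -> Q (n + t%:Z) (cdiff t f s).
Proof.
elim: s j f => //= i s IHs j f Qf [szs].
apply: gfamB => //; first exact/gfamYX/Qf.
case: s szs IHs => [|i' s] //= szs IHs; first exact: gfam0.
case: j szs Qf => // j [szs] Qf.
apply: (IHs j (fun u => f (i :: u))) => /= [u szu|]; last by rewrite szs.
by apply: Qf; rewrite /= szu.
Qed.

Lemma cobounds_shift j n t f r g r' : cobounds Q j n t f r g ->
  cobounds Q j n t f (r + r') (fun u => cmon r' u *: g u).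
Proof.
move=> h s szs; rewrite addnA cdiff_cmon cmonD mulrC -scalerA -scalerBr.
have := gfam_cmon r' s (h s szs); rewrite szs.
by congr Q; lia.
Qed.

Lemma cocycle_shift j n t f r : cocycle Q j n t f ->
  cocycle Q j n (t + r) (fun u => cmon r u *: f u).
Proof.
move=> h s szs; rewrite cdiff_cmon.
have := gfam_cmon r s (h s szs); rewrite szs.
by congr Q; lia.
Qed.

Lemma null_unshift j n t f r :
  null Q j n (t + r) (fun u => cmon r u *: f u) -> null Q j n t f.
Proof.
move=> [r' [g h]]; exists (r + r')%N, g => s szs.
by have := h s szs; rewrite scalerA addnA [(r + r')%N]addnC cmonD.
Qed.

Lemma nullB j n t f g : null Q j n t f -> null Q j n t g ->
  null Q j n t (fun u => f u - g u).
Proof.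
move=> [r [f' hf]] [r' [g' /(cobounds_shift r) hg]].
move/(cobounds_shift r'): hf => hf.
rewrite addnC in hg; exists (r + r')%N.
exists (fun u => cmon r' u *: f' u - cmon r u *: g' u) => s szs.
have := gfamB QP (hf s szs) (hg s szs).
by rewrite cdiffB scalerBr !opprD !opprK addrACA.
Qed.

Lemma nullZ j n t f b (e : int) : (forall n v, Q n v -> Q (n + e) (b *: v)) ->
  null Q j n t f -> null Q j (n + e) t (fun u => b *: f u).
Proof.
move=> hb [r [g h]]; exists r, (fun u => b *: g u) => s szs.
rewrite cdiffZ scalerA [_ * b]mulrC -scalerA -scalerBr addrAC.
by apply: hb; exact: h.
Qed.

Lemma cocycleZ j n t f b (e : int) : (forall n v, Q n v -> Q (n + e) (b *: v)) ->
  cocycle Q j n t f -> cocycle Q j (n + e) t (fun u => b *: f u).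
Proof. by move=> hb h s szs; rewrite cdiffZ addrAC; apply: hb; exact: h. Qed.

Lemma null_mem j n t f : (forall s, size s = j -> Q (n + (t * j)%N%:Z) (f s)) ->
  null Q j n t f.
Proof.
move=> h; exists 0%N, (fun=> 0) => s szs.
have -> : cdiff (t + 0) (fun=> 0) s = 0.
  have -> : (fun=> 0 : M) = (fun u => 0 *: (fun=> 0) u) :> (seq I -> M).
    by apply/funext => u; rewrite scaler0.
  by rewrite cdiffZ scale0r.
by rewrite subr0 cmon0 scale1r addn0; exact: h.
Qed.

Lemma null_ext j n t f f' : (forall s, size s = j -> f s = f' s) ->
  null Q j n t f -> null Q j n t f'.
Proof. by move=> ff' [r [g h]]; exists r, g => s szs; rewrite -ff' //; exact: h. Qed.

(* The usual contracting homotopy after inverting [Y i]. *)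
Lemma cocycle_torsion j n t f i : cocycle Q j n t f ->
  null Q j (n + t%:Z) t (fun u => Y i ^+ t *: f u).
Proof.
move=> h; exists 0%N, (fun u => f (i :: u)) => s szs.
have := h (i :: s); rewrite /= szs => /(_ erefl).
by rewrite cmon0 scale1r addn0; congr Q; lia.
Qed.

Lemma null0 n t f : null Q 0 n t f <-> Q n (f [::]).
Proof.
split=> [[r [g /(_ [::] erefl)]]|Qf].
  by rewrite /= subr0 /cmon big_nil scale1r muln0 addr0.
by apply: null_mem => s /size0nil ->; rewrite muln0 addr0.
Qed.

End Family.

End Cech.

(** * The long exact sequence of multiplication by an element of degree [e] *)

Section CechMult.
Variables (R : comNzRingType) (M : lmodType R) (I : Type) (Y : I -> R).
Variables (Q : int -> set M) (QP : graded_family Y Q).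
Variables (x : R) (e : nat).
Hypothesis Qx : forall n v, Q n v -> Q (n + e%:Z) (x *: v).

(** The cokernel of [x]: the source in degree [n - e] consists of classes of arbitrary elements of
    [M], so [w] is unrestricted. *)
Definition famx (n : int) : set M := [set v | exists w, Q n (v - x *: w)].

Lemma famxP : graded_family Y famx.
Proof.
split=> [n|n v w [v' hv] [w' hw]|n b v [v' hv]|n i v [v' hv]].
- by exists 0; rewrite scaler0 subr0; exact: (gfam0 QP).
- exists (v' - w'); have := gfamB QP hv hw.
  by rewrite scalerBr !opprD !opprK addrACA.
- exists (b *: v'); have := gfamZ QP b hv.
  by rewrite scalerBr !scalerA [b * x]mulrC.
- exists (Y i *: v'); have := gfamY QP i hv.
  by rewrite scalerBr !scalerA [_ * x]mulrC.
Qed.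

Variable N : int.
Hypothesis Qinj : forall n v, N <= n -> Q (n + e%:Z) (x *: v) -> Q n v.

(** The class of [f] is the image of that of [g] under the connecting map. If [g = d h + x w], then
    [x (f - d w) = 0], so [f = d w]. Injectivity of [x] from degree [N] on suffices, as larger
    denominators raise the degrees of the numerators. *)
Lemma null_of_famx j n t f g :
  (forall s, size s = j.+1 ->
     Q (n + e%:Z + (t * j.+1)%N%:Z) (x *: f s - cdiff Y t g s)) ->
  null Y famx j (n + e%:Z) t g -> null Y Q j.+1 n t f.
Proof.
move=> fg [r [h hh]].
have /choice [w hw] s : exists w, size s = j ->
    Q (n + e%:Z + ((t + r) * j)%N%:Z) (cmon Y r s *: g s - cdiff Y (t + r) h s - x *: w).
  have [szs|nszs] := pselect (size s = j); last by exists 0.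
  by have [w hw] := hh s szs; exists w.
pose p := (`|N|%N + `|n|%N)%N.
exists (r + p)%N, (fun u => cmon Y p u *: w u) => s szs.
rewrite addnA cdiff_cmon cmonD mulrC -scalerA -scalerBr.
apply: Qinj; first by rewrite /p; nia.
have := gfam_cdiff QP (t + r) hw szs.
rewrite cdiffB cdiffZ cdiffB cdiff_cmon cdiffK subr0 => hd.
have hf : Q (n + e%:Z + ((t + r) * j)%N%:Z + (t + r)%N)
    (cmon Y r s *: (x *: f s - cdiff Y t g s)).
  by have := gfam_cmon QP r s (fg s szs); rewrite szs; congr Q; lia.
have := gfam_cmon QP p s (gfamD QP hf hd).
rewrite [cmon Y r s *: (_ - _)]scalerBr addrA subrK.
rewrite [cmon Y r s *: (x *: _)]scalerA [_ * x]mulrC -scalerA -scalerBr.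
rewrite scalerA [_ * x]mulrC -scalerA szs.
by congr Q; lia.
Qed.

(** Exactness at the middle term: a cocycle [f] modulo [x] has [d f = x h]; cancelling [x], [h] is a
    cocycle, hence [h = d w], and [f - x w] is a cocycle for [Q], which bounds. *)
Lemma acyclic_famx j n :
  acyclic Y Q j n -> acyclic Y Q j.+1 (n - e%:Z) -> acyclic Y famx j n.
Proof.
move=> hj hj1 t f hf.
have /choice [h hh] s : exists h, size s = j.+1 ->
    Q (n + (t * j.+1)%N%:Z) (cdiff Y t f s - x *: h).
  have [szs|nszs] := pselect (size s = j.+1); last by exists 0.
  by have [h ?] := hf s szs; exists h.
(* The exponent [p] moves the numerators into degrees at least [N], where [x] can be cancelled. *)
pose p := (`|N|%N + `|n|%N + e)%N.
have h1 : cocycle Y Q j.+1 (n - e%:Z) (t + p) (fun u => cmon Y p u *: h u).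
  move=> s szs; rewrite cdiff_cmon; apply: Qinj; first by rewrite /p; nia.
  have := gfam_cdiff QP t hh szs.
  rewrite cdiffB cdiffK cdiffZ sub0r => /(gfamN QP).
  rewrite opprK => /(gfam_cmon QP p s).
  by rewrite szs !scalerA mulrC; congr Q; lia.
have [r [w hw]] := hj1 _ _ h1.
pose T := (t + p + r)%N; apply: (@null_unshift _ _ _ _ _ _ _ _ _ (p + r)).
rewrite addnA -/T.
have hf1 : cocycle Y Q j n T (fun u => cmon Y (p + r) u *: f u - x *: w u).
  move=> s szs; rewrite cdiffB cdiffZ /T -addnA cdiff_cmon addnA.
  have e1 : Q (n + ((t + p + r) * j.+1)%N)
      (cmon Y (p + r) s *: (cdiff Y t f s - x *: h s)).
    by have := gfam_cmon QP (p + r) s (hh s szs); rewrite szs; congr Q; lia.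
  have e2 : Q (n + ((t + p + r) * j.+1)%N)
      (x *: (cmon Y (p + r) s *: h s - cdiff Y (t + p + r) w s)).
    by have := Qx (hw s szs); rewrite scalerA mulrC -cmonD; congr Q; lia.
  have := gfamD QP e1 e2.
  by rewrite !scalerBr !scalerA [x * _]mulrC addrA subrK.
have [r' [u hu]] := hj _ _ hf1.
exists r', u => s szs; exists (cmon Y r' s *: w s).
have := hu s szs.
by rewrite scalerBr !scalerA [x * _]mulrC addrAC.
Qed.

End CechMult.

(** * Regular sequences force vanishing *)

Section RadicalSet.
Variable R : comNzRingType.

(** Membership in the radical of the ideal generated by the [Y i] is expressed below as membership
    in every radical set containing them. *)
Record radical_set (T : set R) : Prop := RadicalSet {
  rad_add : forall p q, T p -> T q -> T (p + q);
  rad_mul : forall p q, T q -> T (p * q);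
  rad_root : forall p N, T (p ^+ N) -> T p }.

End RadicalSet.

Section RegularAcyclic.
Variables (R : comNzRingType) (M : lmodType R) (I : Type) (Y : I -> R).

Lemma const_family (S : set M) : S 0 -> (forall v w, S v -> S w -> S (v - w)) ->
  (forall b v, S v -> S (b *: v)) -> graded_family Y (fun=> S).
Proof. by move=> S0 SB SZ; split=> // n i v; exact: SZ. Qed.

Section ConstFamily.
Variables (S : set M) (SP : graded_family Y (fun=> S)).

Lemma torsion_radical j n t f : cocycle Y (fun=> S) j n t f ->
  radical_set [set p | exists N, null Y (fun=> S) j n t (fun u => p ^+ N *: f u)].
Proof.
move=> hf.
have nullZ0 b g : null Y (fun=> S) j n t g -> null Y (fun=> S) j n t (fun u => b *: g u).
  move=> /(@nullZ _ _ _ _ _ j n t g b 0); rewrite addr0; apply => _ v.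
  exact: (@gfamZ _ _ _ _ _ SP 0).
split=> [p q [N hN] [N' hN']|p q [N hN]|p N [N' hN']].
- exists (N + N')%N; pose g u := p ^+ N *: f u; pose g' u := q ^+ N' *: f u.
  have [a [b ->]] : exists a b, (p + q) ^+ (N + N') = a * p ^+ N + b * q ^+ N'.
    rewrite exprDn; elim/big_ind: _ => [|u v [a [b ->]] [a' [b' ->]]|i _].
    - by exists 0, 0; rewrite !mul0r addr0.
    - by exists (a + a'), (b + b'); ring.
    have [le_N'i|lt_iN'] := leqP N' i.
      exists 0, (p ^+ (N + N' - i) * q ^+ (i - N') *+ 'C(N + N', i)).
      by rewrite mul0r add0r mulrnAl -mulrA -exprD subnK.
    exists (p ^+ (N' - i) * q ^+ i *+ 'C(N + N', i)), 0.
    have -> : (N + N' - i = (N' - i) + N)%N by lia.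
    by rewrite exprD mul0r addr0 mulrnAl mulrAC.
  have := nullB SP (nullZ0 a _ hN) (nullZ0 (- b) _ hN').
  by apply: null_ext => u _; rewrite scaleNr opprK !scalerA scalerDl.
- exists N; apply: null_ext (nullZ0 (p ^+ N) _ hN) => u _.
  by rewrite exprMn scalerA.
- by exists (N * N')%N; apply: null_ext hN' => u _; rewrite exprM.
Qed.

(** Each class is killed by a power of [x], because it is killed by powers of the [Y i]. But [x]
    acts injectively on classes: for [j = 0] by regularity, for [j > 0] by the connecting map and
    the vanishing modulo [x] in index [j - 1]. *)
Lemma acyclic_of_regular x j : (forall T, radical_set T -> (forall i, T (Y i)) -> T x) ->
  (forall v, S (x *: v) -> S v) ->
  (forall j', j' < j -> acyclic Y (famx (fun=> S) x) j' 0)%N ->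
  acyclic Y (fun=> S) j 0.
Proof.
move=> radx xS hj t f hf.
have SZ b v : S v -> S (b *: v) by exact: (@gfamZ _ _ _ _ _ SP 0).
have xinj g : cocycle Y (fun=> S) j 0 t g ->
    null Y (fun=> S) j 0 t (fun u => x *: g u) -> null Y (fun=> S) j 0 t g.
  move=> hg; case: j hj hg {hf} => [|j] hj hg.
    by move=> /null0 hxg; apply/null0/xS.
  move=> [r [h hh]]; apply: (@null_unshift _ _ _ _ _ _ _ _ _ r).
  apply: (@null_of_famx _ _ _ _ _ SP x 0 0 _ _ _ _ _ h) => //.
  - by move=> n v _; exact: xS.
  - by move=> s szs; have := hh s szs; rewrite /= !scalerA mulrC.
  apply: (hj j (ltnSn j) (t + r)%N h) => s szs.
  exists (cmon Y r s *: g s); have := gfamN SP (hh s szs).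
  by rewrite opprB !scalerA mulrC; exact.
have [N] : exists N, null Y (fun=> S) j 0 t (fun u => x ^+ N *: f u).
  apply: (radx _ (torsion_radical hf)) => i; exists t.
  exact: (cocycle_torsion i hf).
elim: N => [|N IHN] hN.
  by apply: null_ext hN => u _; rewrite expr0 scale1r.
apply/IHN/xinj; first by move=> s szs; rewrite cdiffZ; exact/SZ/hf.
by apply: null_ext hN => u _; rewrite exprS scalerA.
Qed.

End ConstFamily.

Lemma seq_mul_rcons (s : seq R) x :
  seq_mul (rcons s x) = [set v : M | exists w, seq_mul s (v - x *: w)].
Proof.
apply/seteqP; split=> [v [u ->]|v [w [u hu]]].
  exists (u (size s)), u; rewrite size_rcons big_ord_recr /= nth_rcons ltnn eqxx addrK.
  by apply: eq_bigr => i _; rewrite nth_rcons ltn_ord.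
exists (fun i => if i == size s then w else u i).
rewrite size_rcons big_ord_recr /= nth_rcons ltnn !eqxx.
rewrite -[LHS](subrK (x *: w)) hu; congr (_ + _); apply: eq_bigr => i _.
by rewrite nth_rcons ltn_ord ltn_eqF.
Qed.

Lemma seq_mul_nil : seq_mul [::] = [set 0 : M].
Proof.
apply/seteqP; split=> [v [u ->]|v ->]; first by rewrite big_ord0.
by exists (fun=> 0); rewrite big_ord0.
Qed.

Lemma seq_mul_family (s : seq R) : graded_family Y (fun=> @seq_mul R M s).
Proof.
elim/last_ind: s => [|s x IHs].
  rewrite seq_mul_nil; apply: const_family => //= [v w -> ->|b v ->].
    by rewrite subr0.
  by rewrite scaler0.
rewrite seq_mul_rcons; apply: (@famxP _ _ _ _ _ IHs).
Qed.

(** Induction on the number of elements of [s] not yet divided out; dividing by one more element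
    costs one cohomological index. *)
Lemma regular_acyclic (s : seq R) :
  (forall x, x \in s -> forall T, radical_set T -> (forall i, T (Y i)) -> T x) ->
  (forall i : nat, (i < size s)%N -> forall u : M,
     seq_mul (take i s) (s`_i *: u) -> seq_mul (take i s) u) ->
  forall i j : nat, (i + j < size s)%N ->
  acyclic Y (fun=> @seq_mul R M (take i s)) j 0.
Proof.
move=> radS regS i j; move: {2}(size s - i)%N (leqnn (size s - i)) => k.
elim: k i j => [|k IHk] i j; first by lia.
move=> hk hij; have lti : (i < size s)%N by lia.
apply: (@acyclic_of_regular _ (seq_mul_family _) s`_i).
- by apply: radS; exact: mem_nth.
- by move=> v; exact: regS.
move=> j' ltj'; have := IHk i.+1 j'; rewrite (take_nth 0) // seq_mul_rcons.
by apply; lia.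
Qed.

End RegularAcyclic.

(** * Noetherianity of the Rees algebra *)

Section MoreIdeals.
Variable R : comNzRingType.
Implicit Types (I J K X : ideal R).

Lemma ideal_subr I x y : I x -> I y -> I (x - y).
Proof. by move=> Ix Iy; apply: ideal_add => //; exact: ideal_opp. Qed.

Lemma idealI_subproof I J : is_ideal [set x | I x /\ J x].
Proof.
split=> [|x y [? ?] [? ?]|c x [? ?]]; split;
  by [exact: ideal_zero|exact: ideal_add|exact: ideal_mull].
Qed.
Definition idealI I J := Ideal (idealI_subproof I J).

Lemma idealD_subproof I J : is_ideal [set x | exists y, I y /\ J (x - y)].
Proof.
split=> [|x y [u [Iu Jxu]] [v [Iv Jyv]]|c x [u [Iu Jxu]]].
- by exists 0; rewrite subr0; split; exact: ideal_zero.
- by exists (u + v); rewrite opprD addrACA; split; exact: ideal_add.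
- by exists (c * u); rewrite -mulrBr; split; exact: ideal_mull.
Qed.
Definition idealD I J := Ideal (idealD_subproof I J).

Lemma principal_subproof (x : R) : is_ideal [set x * y | y in [set: R]].
Proof.
split=> [|_ _ [u _ <-] [v _ <-]|c _ [u _ <-]].
- by exists 0; rewrite ?mulr0.
- by exists (u + v); rewrite ?mulrDr.
- by exists (c * u); rewrite // mulrCA.
Qed.
Definition principal x := Ideal (principal_subproof x).

Lemma colon_subproof I x : is_ideal [set y | I (x * y)].
Proof.
split=> [|u v|c u] /=; first by rewrite mulr0; exact: ideal_zero.
  by rewrite mulrDr; exact: ideal_add.
by rewrite mulrCA; exact: ideal_mull.
Qed.
Definition colon I x := Ideal (colon_subproof I x).

Lemma idealDl I J x : I x -> idealD I J x.
Proof. by exists x; rewrite subrr; split=> //; exact: ideal_zero. Qed.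

Lemma idealDr I J x : J x -> idealD I J x.
Proof. by exists 0; rewrite subr0; split=> //; exact: ideal_zero. Qed.

Lemma ideal_gen_min (S : set R) K : S `<=` K -> ideal_gen S `<=` K.
Proof. by move=> SK; apply: smallest_sub => //; exact: ideal_setP. Qed.

Lemma ideal_mul_mono I J K : J `<=` K -> ideal_mul I J `<=` ideal_mul I K.
Proof. by move=> JK; apply: ideal_mul_min => x y Ix /JK; exact: mem_ideal_mul. Qed.

Lemma ideal_exp_sub I n : (0 < n)%N -> ideal_exp I n `<=` I.
Proof.
case: n => // n _; apply: (@ideal_mul_min _ I (ideal_exp I n)) => x y Ix _.
by rewrite mulrC; exact: ideal_mull.
Qed.

Lemma ascending_le (I : nat -> ideal R) : (forall n, I n `<=` I n.+1) ->
  forall m n, (m <= n)%N -> I m `<=` I n.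
Proof.
move=> hI m n /subnK <-; elim: (n - m)%N => [|k IHk] //=.
by rewrite addSn; apply: subset_trans IHk (hI _).
Qed.

Lemma union_subproof (I : nat -> ideal R) : (forall n, I n `<=` I n.+1) ->
  is_ideal [set x | exists n, I n x].
Proof.
move=> hI; split=> [|x y [m Imx] [n Iny]|c x [n Inx]].
- by exists 0%N; exact: ideal_zero.
- exists (m + n)%N; apply: ideal_add; first exact: (ascending_le hI (leq_addr _ _)) Imx.
  exact: (ascending_le hI (leq_addl _ _)) Iny.
- by exists n; exact: ideal_mull.
Qed.

Hypothesis noeR : noetherian R.

Lemma noetherian_uniform (I : nat -> ideal R) J : (forall n, I n `<=` I n.+1) ->
  (forall x, J x -> exists n, I n x) -> exists n, J `<=` I n.
Proof.
move=> hI JI; have [s Js] := noeR J.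
have sJ : [set x | x \in s] `<=` J by rewrite Js; exact: sub_gen_smallest.
suff [n hn] : exists n, [set x | x \in s] `<=` I n.
  by exists n; rewrite Js; exact: ideal_gen_min.
elim: s {Js} sJ => [|x s IHs] sJ; first by exists 0%N.
have [|n hn] := IHs; first by move=> y ys; apply: sJ; rewrite /= inE ys orbT.
have [m hm] : exists m, I m x by apply/JI/sJ; rewrite /= mem_head.
exists (m + n)%N => y; rewrite /= inE => /orP[/eqP->|/hn].
  exact: (ascending_le hI (leq_addr _ _)).
exact: (ascending_le hI (leq_addl _ _)).
Qed.

Lemma noetherian_acc (I : nat -> ideal R) : (forall n, I n `<=` I n.+1) ->
  exists N, forall n, I n `<=` I N.
Proof.
move=> hI; have [//|N hN] := @noetherian_uniform I (Ideal (union_subproof hI)) hI.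
by exists N => n x Ix; apply: hN; exists n.
Qed.

End MoreIdeals.

Section HilbertBasis.
Variables (R : comNzRingType) (noeR : noetherian R).

Lemma lead_ideal_subproof (I : ideal {poly R}) (n : nat) :
  is_ideal [set c | exists p, [/\ I p, (size p <= n.+1)%N & p`_n = c]].
Proof.
split=> [|_ _ [p [Ip sp <-]] [q [Iq sq <-]]|c _ [p [Ip sp <-]]].
- by exists 0; rewrite size_poly0 coef0; split=> //; exact: ideal_zero.
- exists (p + q); rewrite coefD; split=> //; first exact: ideal_add.
  by rewrite (leq_trans (size_polyD _ _)) // geq_max sp.
- exists (c%:P * p); rewrite coefCM; split=> //; first exact: ideal_mull.
  by rewrite mul_polyC (leq_trans (size_scale_leq _ _)).
Qed.
Definition lead_ideal I n := Ideal (lead_ideal_subproof I n).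

Lemma hilbert_basis : noetherian {poly R}.
Proof.
move=> I; have hL n : lead_ideal I n `<=` lead_ideal I n.+1.
  move=> _ [p [Ip sp <-]]; exists ('X * p).
  rewrite coefXM; split=> //; first exact: ideal_mull.
  by rewrite mulrC (leq_trans (size_polyMleq _ _)) // size_polyX addn2.
have [N hN] := noetherian_acc noeR hL.
have /choice [lg hlg] n := noeR (lead_ideal I n).
have /choice [pk hpk] (nc : nat * R) : exists p, lead_ideal I nc.1 nc.2 ->
    [/\ I p, (size p <= nc.1.+1)%N & p`_(nc.1) = nc.2].
  have [[p hp]|h] := pselect (lead_ideal I nc.1 nc.2); last by exists 0.
  by exists p.
pose s := flatten [seq [seq pk (n, c) | c <- lg n] | n <- iota 0 N.+1].
have sP n c : (n <= N)%N -> c \in lg n -> pk (n, c) \in s.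
  move=> lenN cn; apply/flatten_mapP; exists n; last exact: map_f.
  by rewrite mem_iota.
have lgI n c : c \in lg n -> lead_ideal I n c.
  by move=> hc; rewrite hlg; exact: sub_gen_smallest.
pose G := ideal_gen [set x | x \in s].
have leadG n c : (n <= N)%N -> lead_ideal I n c -> lead_ideal G n c.
  move=> lenN; rewrite hlg; move: c; apply: ideal_gen_min => c /= hc.
  have [_ sz cf] := hpk (n, c) (lgI _ _ hc).
  by exists (pk (n, c)); split=> //; apply: sub_gen_smallest; exact: sP.
exists s; apply/seteqP; split; last first.
  apply: ideal_gen_min => p /flatten_mapP [n _ /mapP [c hc ->]].
  by have [] := hpk (n, c) (lgI _ _ hc).
move=> p; move: {2}(size p) (leqnn (size p)) => k.
elim: k p => [|k IHk] p.
  by rewrite leqn0 size_poly_eq0 => /eqP -> _; exact: ideal_zero.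
move=> szp Ip; pose m := minn k N.
have [] : lead_ideal G m p`_k.
  apply: leadG; first exact: geq_minr.
  have lk : lead_ideal I k p`_k by exists p.
  by rewrite /m; case: (leqP k N) => // _; exact: hN lk.
move=> q [Gq szq cq]; have GI : G `<=` I.
  apply: ideal_gen_min => u /flatten_mapP [n _ /mapP [c hc ->]].
  by have [] := hpk (n, c) (lgI _ _ hc).
rewrite -(subrK ('X^(k - m) * q) p); apply: ideal_add; last exact: ideal_mull.
apply: IHk; last by apply: ideal_subr => //; apply: ideal_mull; exact: GI.
have lemk : (m <= k)%N by exact: geq_minl.
apply/leq_sizeP => i leki; rewrite coefB coefXnM.
have -> : (i < k - m)%N = false by lia.
move: leki; rewrite leq_eqVlt => /orP[/eqP <-|ltki].
  by rewrite subKn // cq subrr.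
rewrite (nth_default _ (leq_trans szp ltki)) nth_default ?subr0 //.
by rewrite (leq_trans szq) //; lia.
Qed.

End HilbertBasis.

Section ReesNoetherian.
Variables (A : comNzRingType) (noeA : noetherian A) (a : ideal A).

Lemma exp_ideal_absorb (W : nat -> ideal A) :
  (forall n b w, a b -> W n w -> W n.+1 (b * w)) ->
  forall m n b w, ideal_exp a m b -> W n w -> W (m + n)%N (b * w).
Proof.
move=> hW; elim=> [|m IHm] n b w /=; first by move=> _; exact: ideal_mull.
move=> hb Ww; rewrite mulrC; move: b hb; apply: ideal_mul_ind => u v au av.
by rewrite mulrC -mulrA; apply: hW => //; exact: IHm.
Qed.

Lemma exp_idealS n : ideal_exp a n.+1 = ideal_mul a (ideal_exp a n).
Proof. by []. Qed.

(** [S] is an iterated polynomial ring over [A] with one variable for each generator [y] of [a],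
    sent to [y *: 'X]. The image of [phi] is the Rees algebra, which thus inherits finiteness from
    [S]. *)
Lemma rees_cover : exists (S : comNzRingType) (phi : {rmorphism S -> {poly A}}),
  [/\ noetherian S, forall s n, ideal_exp a n (phi s)`_n &
      forall n c, ideal_exp a n c -> exists s, phi s = c *: 'X^n].
Proof.
have [ys aE] := noeA a.
have ysa : [set x | x \in ys] `<=` a by rewrite aE; exact: sub_gen_smallest.
suff [S [phi [noeS hphi hc hy]]] : exists (S : comNzRingType) (phi : {rmorphism S -> {poly A}}),
    [/\ noetherian S, forall s n, ideal_exp a n (phi s)`_n,
      forall c, exists s, phi s = c%:P &
      forall y, y \in ys -> exists s, phi s = y *: 'X].
  exists S, phi; split=> //.
  have idc n : is_ideal [set c | exists s, phi s = c *: 'X^n].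
    split=> [|c c' [s hs] [s' hs']|b c [s hs]].
    - by exists 0; rewrite rmorph0 scale0r.
    - by exists (s + s'); rewrite rmorphD hs hs' scalerDl.
    - have [s' hs'] := hc b; exists (s' * s).
      by rewrite rmorphM hs hs' mul_polyC scalerA.
  elim=> [|n IHn] c; first by move=> _; have [s hs] := hc c; exists s; rewrite hs alg_polyC.
  rewrite exp_idealS; move: c.
  apply: (@ideal_mul_min _ _ _ (Ideal (idc n.+1))) => b c ab /IHn [s hs].
  have [s' hs'] : exists s, phi s = b *: 'X.
    move: b ab; rewrite aE => b.
    apply: (@ideal_gen_min _ _ (Ideal (idc 1%N))) => y /hy [u hu].
    by exists u.
  exists (s' * s); rewrite rmorphM hs hs' exprS.
  by rewrite -scalerAl -scalerAr scalerA.
elim: ys {aE} ysa => [|y ys IHys] ysa.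
  exists A, (@polyC A : {rmorphism A -> {poly A}}); split=> // [s n|c]; last by exists c.
  by rewrite coefC; case: n => [|n] //=; exact: ideal_zero.
have [|S [phi [noeS hphi hc hy]]] := IHys.
  by move=> z hz; apply: ysa; rewrite /= inE hz orbT.
have cfu : commr_rmorph phi (y *: 'X) by move=> s; exact: mulrC.
exists {poly S}, (horner_morph cfu : {rmorphism {poly S} -> {poly A}}).
split=> [|s|c|z].
- exact: hilbert_basis.
- elim/poly_ind: s => [|p s IHp] n.
    by rewrite rmorph0 coef0; exact: ideal_zero.
  rewrite rmorphD rmorphM /= horner_morphX horner_morphC coefD; apply: ideal_add => //.
  rewrite -scalerAr coefZ coefMX; case: n => [|n] //=.
  apply: mem_ideal_mul; last exact: IHp.
  by apply: ysa; rewrite /= mem_head.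
- by have [s hs] := hc c; exists s%:P; rewrite /= horner_morphC.
- rewrite inE => /orP[/eqP ->|/hy [s hs]]; last by exists s%:P; rewrite /= horner_morphC.
  by exists 'X; rewrite /= horner_morphX.
Qed.

(** The preimage in [S] of the homogeneous ideal [W] is finitely generated; beyond the degrees of
    the generators every coefficient involves a multiplier of positive degree, which supplies the
    factor in [a]. *)
Lemma rees_family_fg (W : nat -> ideal A) :
  (forall n, W n `<=` ideal_exp a n) ->
  (forall n b w, a b -> W n w -> W n.+1 (b * w)) ->
  exists n1, forall n, (n1 <= n)%N -> W n.+1 `<=` ideal_mul a (W n).
Proof.
move=> Wa hW; have [S [phi [noeS hphi hc]]] := rees_cover.
have absW := exp_ideal_absorb hW.
have idW : is_ideal [set s | forall n, W n (phi s)`_n].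
  split=> [n|s s' hs hs' n|c s hs n].
  - by rewrite rmorph0 coef0; exact: ideal_zero.
  - by rewrite rmorphD coefD; exact: ideal_add.
  - rewrite rmorphM coefM; apply: ideal_sum => i _.
    by have := absW i (n - i)%N _ _ (hphi c i) (hs (n - i)%N); rewrite subnKC // -ltnS.
have [ss hss] := noeS (Ideal idW).
pose N := \max_(s <- ss) size (phi s).
have idT : is_ideal [set s | (forall n, W n (phi s)`_n) /\
    forall n, (N <= n)%N -> ideal_mul a (W n) (phi s)`_n.+1].
  split=> [|s s' [ws hs] [ws' hs']|c s [ws hs]].
  - by split=> n *; rewrite rmorph0 coef0; exact: ideal_zero.
  - by split=> n *; rewrite rmorphD coefD; apply: ideal_add; auto.
  - split; first by have [_ _ /(_ c s ws)] := idW.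
    move=> n leNn; rewrite rmorphM coefM; apply: ideal_sum => -[[|i] lti] _ /=.
      by rewrite subn0; apply: ideal_mull; exact: hs.
    rewrite mulrC; move: (hphi c i.+1); rewrite exp_idealS.
    move: {c}(phi c)`_i.+1; apply: ideal_mul_ind => u v au av.
    rewrite mulrC -mulrA; apply: mem_ideal_mul => //.
    have := absW i (n.+1 - i.+1)%N v _ av (ws (n.+1 - i.+1)%N).
    by rewrite subSS subnKC // -ltnS.
exists N => n leNn w Ww; have [s hs] := hc _ _ (Wa _ _ Ww).
have : Ideal idW s.
  move=> k; rewrite hs coefZ coefXn; case: eqP => [->|_]; first by rewrite mulr1.
  by rewrite mulr0; exact: ideal_zero.
have -> : w = (phi s)`_n.+1 by rewrite hs coefZ coefXn eqxx mulr1.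
rewrite hss => /(@ideal_gen_min _ _ (Ideal idT)) [|_]; last exact.
move=> t /= ts; split.
  have : Ideal idW t by rewrite hss; exact: sub_gen_smallest.
  exact.
move=> k leNk; rewrite nth_default; first exact: ideal_zero.
apply: leq_trans (leqW leNk); rewrite /N.
by rewrite (big_rem _ ts) /= leq_maxl.
Qed.

End ReesNoetherian.

(** * Homogeneous primes and superficial elements *)

Section GradedIdeals.
Variables (A : comNzRingType) (noeA : noetherian A) (a : ideal A).
Variable F : stable_filtration a.

(** Graded submodules of [\bigoplus F n t^n] over the Rees algebra of [a]. *)
Definition graded_ideal (W : nat -> ideal A) : Prop :=
  (forall n, W n `<=` F n) /\
  (forall n b w, a b -> W n w -> W n.+1 (b * w)).

Lemma fil_tail : exists n0, forall l, F (n0 + l)%N `<=` ideal_exp a l.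
Proof.
have [n0 hn0] := @sfil_stable _ _ F; exists n0; elim=> [|l IHl] //.
rewrite addnS -hn0 ?leq_addr //.
exact: ideal_mul_mono.
Qed.

(** By stability [F (n0 + l)] lies in [ideal_exp a l], so the tail of [W], shifted by [n0], is a
    homogeneous ideal of the Rees algebra. *)
Lemma graded_ideal_fg W : graded_ideal W ->
  exists n1, forall n, (n1 <= n)%N -> W n.+1 `<=` ideal_mul a (W n).
Proof.
move=> [WF aW]; have [n0 hn0] := fil_tail.
have [||n1 h] := @rees_family_fg _ noeA a (fun l => W (n0 + l)%N).
- by move=> l; apply: subset_trans (hn0 l); exact: WF.
- by move=> l b w; rewrite addnS; exact: aW.
exists (n0 + n1)%N => n hn; have := h (n - n0)%N; rewrite addnS subnKC; last by lia.
by apply; lia.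
Qed.

Lemma fg_iter (W : nat -> ideal A) n1 :
  (forall n, (n1 <= n)%N -> W n.+1 `<=` ideal_mul a (W n)) ->
  forall l, W (n1 + l)%N `<=` ideal_mul (ideal_exp a l) (W n1).
Proof.
move=> hW; elim=> [|l IHl] w.
  by rewrite addn0 => hw; rewrite -[w]mul1r; exact: mem_ideal_mul.
rewrite addnS => /hW; rewrite leq_addr => /(_ isT); move: w.
apply: ideal_mul_min => b w ab /IHl; apply: ideal_mul_ind => u v au Wv.
by rewrite mulrA; apply: mem_ideal_mul => //; exact: mem_ideal_mul.
Qed.

(** Otherwise choice gives a strictly increasing chain. Its union is generated in degrees up to
    [n1], and finitely many degrees stabilise simultaneously. *)
Lemma graded_ideal_max (S : set (nat -> ideal A)) :
  (forall W, S W -> graded_ideal W) -> (exists W, S W) ->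
  exists2 W, S W & forall W', S W' -> (forall n, W n `<=` W' n) ->
    forall n, W' n `<=` W n.
Proof.
move=> SP [W0 SW0]; apply: contrapT => nomax.
have /choice [g hg] W : exists W', S W ->
    [/\ S W', forall n, W n `<=` W' n & ~ forall n, W' n `<=` W n].
  have [SW|nSW] := pselect (S W); last by exists W.
  apply: contrapT => hW; apply: nomax; exists W => // W' SW' WW'.
  by apply: contrapT => h; apply: hW; exists W'.
pose C i := iter i g W0.
have SC i : S (C i) by elim: i => //= i /hg [].
have CS i n : C i n `<=` C i.+1 n by have [_ + _] := hg _ (SC i); apply.
pose U n := Ideal (union_subproof (fun i => @CS i n)).
have gU : graded_ideal U.
  split=> [n w [i]|n b w ab [i Cw]]; first by have [+ _] := SP _ (SC i); apply.
  by exists i; have [_ +] := SP _ (SC i); apply.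
have [n1 hn1] := graded_ideal_fg gU.
have [N hN] : exists N, forall n, (n <= n1)%N -> U n `<=` C N n.
  elim: (n1) => [|k [N hN]].
    have [N hN] := noetherian_acc noeA (fun i => @CS i 0%N).
    by exists N => n; rewrite leqn0 => /eqP -> w [i Cw]; exact: hN Cw.
  have [N' hN'] := noetherian_acc noeA (fun i => @CS i k.+1).
  exists (N + N')%N => n; rewrite leq_eqVlt => /orP[/eqP -> w [i /hN' Cw]|].
    exact: (ascending_le (fun i => @CS i k.+1) (leq_addl _ _)) Cw.
  rewrite ltnS => /hN h w /h.
  exact: (ascending_le (fun i => @CS i n) (leq_addr _ _)).
have UN n : U n `<=` C N n.
  elim: n => [|n IHn]; first exact: hN.
  have [/hN //|/hn1 h] := leqP n.+1 n1.
  apply: subset_trans h _; apply: ideal_mul_min => b w ab /IHn.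
  by have [_ +] := SP _ (SC N); apply.
have [_ _] := hg _ (SC N); apply => n w Cw.
by apply: UN; exists N.+1.
Qed.

End GradedIdeals.

Section AssociatedPrimes.
Variables (A : comNzRingType) (noeA : noetherian A) (a : ideal A).
Variable F : stable_filtration a.

(* a homogeneous prime [\bigoplus_n P n t^n] of the Rees algebra of [a] *)
Record graded_prime (P : nat -> ideal A) : Prop := GradedPrime {
  gprime_mul : forall n b w, a b -> P n w -> P n.+1 (b * w);
  gprimeP : forall e f b c, ideal_exp a e b -> ideal_exp a f c ->
    P (e + f)%N (b * c) -> P e b \/ P f c;
  gprime_proper : exists2 w, a w & ~ P 1%N w }.

Lemma gprime_absorb P : graded_prime P ->
  forall m n b w, ideal_exp a m b -> P n w -> P (m + n)%N (b * w).
Proof. by move=> hP; apply: exp_ideal_absorb; exact: gprime_mul. Qed.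

Lemma ideal_exp_pow e x k : ideal_exp a e x -> ideal_exp a (k * e)%N (x ^+ k).
Proof.
move=> ax; elim: k => [|k IHk] //.
by rewrite mulSn exprS; exact: ideal_expD.
Qed.

Lemma gprime_pow P e x k : graded_prime P -> ideal_exp a e x -> (0 < k)%N ->
  P (k * e)%N (x ^+ k) <-> P e x.
Proof.
move=> hP ax; case: k => // k _; elim: k => [|k IHk].
  by rewrite mul1n expr1.
rewrite mulSn exprS; split=> [/(gprimeP hP)|Px].
  by case=> //; [exact: ideal_exp_pow|move/IHk].
by apply: gprime_absorb => //; exact/IHk.
Qed.

Lemma prime_avoidance q (P : nat -> nat -> ideal A) :
  (forall i, (i < q)%N -> graded_prime (P i)) ->
  exists e x, [/\ (0 < e)%N, ideal_exp a e x & forall i, (i < q)%N -> ~ P i e x].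
Proof.
elim: q => [|q IHq] hP.
  by exists 1%N, 0; split=> //; exact: ideal_zero.
have [|e [x [e0 ax xP]]] := IHq; first by move=> i lti; apply: hP; exact: leqW.
have := hP q (ltnSn q); set Pq := P q => hPq.
have [xPq|] := pselect (Pq e x); last first.
  move=> h; exists e, x; split=> // i; rewrite ltnS leq_eqVlt => /orP[/eqP -> //|].
  exact: xP.
(* [x] fails only at [Pq]. It is corrected by some [z] outside [Pq] lying in each earlier prime not
   contained in [Pq]; the primes contained in [Pq] are avoided along with [Pq]. *)
have [f [z [f0 az zPq zP]]] : exists f z, [/\ (0 < f)%N, ideal_exp a f z, ~ Pq f z &
    forall i, (i < q)%N -> (forall k c, ideal_exp a k c -> P i k c -> Pq k c) \/ P i f z].
  have : forall i, (i < q)%N -> graded_prime (P i) by move=> i lti; apply: hP; exact: leqW.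
  elim: (q) => [|k IHk] hPk.
    have [w aw Pw] := gprime_proper hPq; exists 1%N, w; split=> //.
    by rewrite ideal_exp1.
  have [|f [z [f0 az zPq zP]]] := IHk; first by move=> i lti; apply: hPk; exact: leqW.
  have [sub|/existsNP [m /existsNP [c /not_implyP [ac /not_implyP [Pc nPqc]]]]] :=
    pselect (forall m c, ideal_exp a m c -> P k m c -> Pq m c).
    exists f, z; split=> // i; rewrite ltnS leq_eqVlt => /orP[/eqP ->|/zP //].
    by left.
  exists (m + f)%N, (c * z); split; first by rewrite ltn_addl.
  - exact: ideal_expD.
  - by case/(gprimeP hPq).
  move=> i; rewrite ltnS leq_eqVlt => /orP[/eqP ->|lti].
    right; rewrite mulrC addnC; apply: gprime_absorb => //; exact: hPk.
  have [|Pz] := zP i lti; first by left.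
  by right; apply: gprime_absorb => //; apply: hPk; exact: leqW.
(* [x] and [z] have degrees [e] and [f]; [x ^+ f + z ^+ e] is homogeneous *)
have axf := ideal_exp_pow f ax.
have azf : ideal_exp a (f * e)%N (z ^+ e) by rewrite mulnC; exact: ideal_exp_pow.
have nPq : ~ Pq (f * e)%N (x ^+ f + z ^+ e).
  move=> h; apply: zPq; apply/(gprime_pow hPq az e0).
  have -> : z ^+ e = x ^+ f + z ^+ e - x ^+ f by rewrite addrC addKr.
  by rewrite mulnC; apply: ideal_subr => //; apply/(gprime_pow hPq ax f0).
exists (f * e)%N, (x ^+ f + z ^+ e); split; first by rewrite muln_gt0 f0.
  exact: ideal_add.
move=> i; rewrite ltnS leq_eqVlt => /orP[/eqP -> //|lti].
have [sub|Pz] := zP i lti; first by move=> /sub h; apply/nPq/h; exact: ideal_add.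
have Pi := hP i (leqW lti) => h; apply: (xP i lti); apply/(gprime_pow Pi ax f0).
have -> : x ^+ f = x ^+ f + z ^+ e - z ^+ e by rewrite addrK.
by apply: ideal_subr => //; rewrite mulnC; apply/(gprime_pow Pi az e0).
Qed.

Section Annihilators.
Variable Q : nat -> ideal A.
Hypothesis QP : forall n b w, a b -> Q n w -> Q n.+1 (b * w).
Variable n0 : nat.
Hypothesis Q_torsion_free : forall n v, (n0 <= n)%N -> F n v ->
  (forall b, a b -> Q n.+1 (b * v)) -> Q n v.

Implicit Type p : nat * A.

(** Degree [e] of the annihilator, in the Rees algebra of [a], of the class of [p.2] in degree [p.1]
    modulo [Q]. *)
Definition gann p (e : nat) : ideal A :=
  idealI (ideal_exp a e) (colon (Q (p.1 + e)%N) p.2).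

Definition nonzero_class p : Prop := [/\ (n0 <= p.1)%N, F p.1 p.2 & ~ Q p.1 p.2].

Definition maximal_gann p : Prop := nonzero_class p /\
  forall p', nonzero_class p' -> (forall e, gann p e `<=` gann p' e) ->
  forall e, gann p' e `<=` gann p e.

Let F_proper := stable_proper F.

Lemma gann_graded p : graded_ideal (adic F_proper) (gann p).
Proof.
split=> [n w []//|n b w ab [aw Qw]]; split; first exact: mem_ideal_mul.
by change (Q (p.1 + n.+1)%N (p.2 * (b * w))); rewrite addnS mulrCA; exact: QP.
Qed.

Lemma maximal_gann_exists p : nonzero_class p ->
  exists2 p', maximal_gann p' & forall e, gann p e `<=` gann p' e.
Proof.
move=> hp; pose S := [set W | exists p', [/\ nonzero_class p',
  forall e, gann p e `<=` gann p' e & W = gann p']].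
have [||] := @graded_ideal_max _ noeA a (adic F_proper) S.
- by move=> _ [p' [_ _ ->]]; exact: gann_graded.
- by exists (gann p), p; split=> // e b.
move=> _ [p' [hp' pp' ->]] hmax; exists p' => //; split=> // p'' hp'' h.
apply: hmax => //; exists p''; split=> // e.
exact: subset_trans (pp' e) (h e).
Qed.

(** If [c] does not kill the class of [p], the annihilator of the multiple by [c] contains [gann p],
    hence equals it, and [b] kills this multiple. Properness comes from [Q_torsion_free]. *)
Lemma maximal_gann_prime p : maximal_gann p -> graded_prime (gann p).
Proof.
move=> [[le_n0 Fp Qp] hmax]; split.
- by move=> n b w; case: (gann_graded p) => _; apply.
- move=> e f b c ab ac [abc Qbc].
  have [Qc|nQc] := pselect (Q (p.1 + f)%N (p.2 * c)); [by right; split|left].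
  apply: (hmax ((p.1 + f)%N, p.2 * c)) => //=.
  + split=> //=; first exact: leq_trans le_n0 (leq_addr _ _).
    by apply: fil_mulP => //; exact: exp_sub_fil.
  + move=> k d [ad Qd]; split=> //.
    change (Q (p.1 + f + k)%N (p.2 * c * d)).
    have -> : p.2 * c * d = c * (p.2 * d) by ring.
    have -> : (p.1 + f + k = f + (p.1 + k))%N by lia.
    exact: (exp_ideal_absorb QP ac Qd).
  + split=> //; change (Q (p.1 + f + e)%N (p.2 * c * b)).
    have -> : p.2 * c * b = p.2 * (b * c) by ring.
    by have -> : (p.1 + f + e = p.1 + (e + f))%N by lia.
- apply: contrapT => h; apply: Qp; apply: Q_torsion_free => // b ab.
  apply: contrapT => nQ; apply: h; exists b => // -[_].
  change (~ Q (p.1 + 1)%N (p.2 * b)).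
  by rewrite addn1 mulrC.
Qed.

(** A maximal submodule spanned by finitely many elements with maximal annihilators contains every
    such [p]. Were no [gann (ps i)] contained in the prime [gann p], a product of elements outside
    [gann p] would kill the whole span and hence [p]; maximality reverses the containment. *)
Lemma finite_maximal_gann : exists q (ps : nat -> nat * A),
  (forall i, (i < q)%N -> maximal_gann (ps i)) /\
  forall p, maximal_gann p -> exists2 i, (i < q)%N &
    forall e, gann p e `<=` gann (ps i) e.
Proof.
pose span q (ps : nat -> nat * A) n := ideal_gen [set w | exists i b,
  [/\ (i < q)%N, ((ps i).1 <= n)%N, ideal_exp a (n - (ps i).1) b & w = b * (ps i).2]].
pose S := [set W | exists q ps, (forall i, (i < q)%N -> maximal_gann (ps i)) /\ W = span q ps].
have [||] := @graded_ideal_max _ noeA a F S.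
- move=> _ [q [ps [hps ->]]]; split=> n.
    apply: ideal_gen_min => w [i [b [lti len ab ->]]].
    have [[_ Fi _] _] := hps i lti.
    rewrite -(subnK len); apply: fil_mulP => //; exact: exp_sub_fil.
  move=> b w ab; apply: (@ideal_gen_min _ _ (colon (span q ps n.+1) b)).
  move=> _ [i [c [lti len ac ->]]]; apply: sub_gen_smallest.
  exists i, (b * c); rewrite mulrA; split=> //; first exact: leqW.
  by rewrite subSn //; exact: mem_ideal_mul.
- by exists (span 0%N (fun=> (0%N, 0))), 0%N, (fun=> (0%N, 0)).
move=> _ [q [ps [hps ->]]] hmax; exists q, ps; split=> // p hp.
have [[_ Fp Qp] _] := hp.
pose ps' i := if i == q then p else ps i.
have span' n : span q ps n `<=` span q.+1 ps' n.
  apply: ideal_gen_min => w [i [b [lti len ab ->]]]; apply: sub_gen_smallest.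
  by exists i, b; rewrite /ps' ltn_eqF // leqW.
have pspan : span q ps p.1 p.2.
  apply: (hmax (span q.+1 ps')) => //.
    exists q.+1, ps'; split=> // i; rewrite ltnS leq_eqVlt /ps'.
    by case: eqP => //= _; exact: hps.
  by apply: sub_gen_smallest; exists q, 1; rewrite /ps' eqxx subnn mul1r.
apply: contrapT => hno.
have [f [z [az zp zps]]] : exists f z, [/\ ideal_exp a f z, ~ gann p f z &
    forall i, (i < q)%N -> gann (ps i) f z].
  have hno' i : (i < q)%N -> exists e b, gann (ps i) e b /\ ~ gann p e b.
    move=> lti; apply: contrapT => h; apply: hno; exists i => //.
    have [[hp1 _] [_ hpi]] := (hp, hps i lti); apply: hpi => // e b ib.
    by apply: contrapT => nb; apply: h; exists e, b.
  have pP := maximal_gann_prime hp.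
  have : forall i, (i < q)%N -> graded_prime (gann (ps i)).
    by move=> i /hps; exact: maximal_gann_prime.
  move: hno'; move: {pspan hmax hno hps span' ps'} q => q.
  elim: q => [|q IHq] hno hps.
    exists 0%N, 1; split=> // -[_].
    by change (Q (p.1 + 0)%N (p.2 * 1) -> False); rewrite addn0 mulr1.
  have [i lti|i lti|f [z [az zp zps]]] := IHq.
  - by apply: hno; exact: leqW.
  - by apply: hps; exact: leqW.
  have [e [b [hb nb]]] := hno q (ltnSn q).
  have [ab _] := hb.
  exists (e + f)%N, (b * z); split; first exact: ideal_expD.
    by case/(gprimeP pP).
  move=> i; rewrite ltnS leq_eqVlt => /orP[/eqP ->|lti].
    by rewrite mulrC addnC; apply: gprime_absorb => //; exact: hps.
  exact: (gprime_absorb (hps i (leqW lti)) ab (zps i lti)).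
apply: zp; split=> //; change (Q (p.1 + f)%N (p.2 * z)); rewrite mulrC.
suff : span q ps p.1 `<=` colon (Q (p.1 + f)%N) z by apply.
apply: ideal_gen_min => _ [i [b [lti len ab ->]]].
have [_ hz] := zps i lti.
change (Q (p.1 + f)%N (z * (b * (ps i).2))).
rewrite mulrCA -(subnK len) -addnA [z * _]mulrC.
exact: (exp_ideal_absorb QP ab hz).
Qed.

(** Every annihilator lies in a maximal one. So a homogeneous element outside finitely many primes
    kills no nonzero class in degrees at least [n0]. *)
Lemma associated_primes : exists q (P : nat -> nat -> ideal A),
  (forall i, (i < q)%N -> graded_prime (P i)) /\
  forall n v, (n0 <= n)%N -> F n v -> ~ Q n v -> exists2 i, (i < q)%N &
    forall e b, ideal_exp a e b -> Q (n + e)%N (b * v) -> P i e b.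
Proof.
have [q [ps [hps psP]]] := finite_maximal_gann.
exists q, (fun i => gann (ps i)); split=> [i /hps|n v le_n0 Fv Qv].
  exact: maximal_gann_prime.
have [//|p' hp' vp'] := @maximal_gann_exists (n, v).
have [i lti hi] := psP _ hp'; exists i => // e b ab Qb.
apply/hi/vp'; split=> //.
by change (Q (n + e)%N (v * b)); rewrite mulrC.
Qed.

End Annihilators.

End AssociatedPrimes.

Section Superficial.
Variables (A : comNzRingType) (noeA : noetherian A) (a : ideal A).
Variable F : stable_filtration a.
Variable X : ideal A.

(** The torsion [W] with respect to [a t] is finitely generated, so one power [r] kills its part of
    degree [n1]; in degree [n1 + r] and beyond it is generated from degree [n1] by multipliers that
    kill it. *)
Lemma graded_torsion : exists n0, forall n v, (n0 <= n)%N -> F n v ->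
  (forall b, a b -> idealD (F n.+2) X (b * v)) -> idealD (F n.+1) X v.
Proof.
pose Q n := idealD (F n.+1) X.
have QP n b w : a b -> Q n w -> Q n.+1 (b * w).
  move=> ab [u [Fu Xwu]]; exists (b * u); rewrite -mulrBr; split.
    by apply: (@fil_mulP _ F 1 n.+1) => //; exact: (@sfil_sub _ _ F).
  exact: ideal_mull.
have idT r n : is_ideal [set v | forall b, ideal_exp a r b -> Q (n + r)%N (b * v)].
  split=> [b _|v w hv hw b ab|c v hv b ab].
  - by rewrite mulr0; exact: ideal_zero.
  - by rewrite mulrDr; apply: ideal_add; auto.
  - by rewrite mulrCA; apply: ideal_mull; exact: hv.
pose T r n := Ideal (idT r n).
have TS n r : T r n `<=` T r.+1 n.
  move=> v Tv b; rewrite mulrC; move: b; apply: ideal_mul_ind => b c ab ac.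
  by rewrite mulrC -mulrA addnS; apply: QP => //; exact: Tv.
have aT r n b v : a b -> T r n v -> T r n.+1 (b * v).
  by move=> ab Tv c ac; rewrite mulrCA addSn; apply: QP => //; exact: Tv.
pose W n := idealI (F n) (Ideal (union_subproof (TS n))).
have gW : graded_ideal F W.
  split=> [n v []//|n b v ab [Fv [r Tv]]]; split; last by exists r; exact: aT.
  by apply: (@fil_mulP _ F 1) => //; exact: (@sfil_sub _ _ F).
have [n1 hn1] := graded_ideal_fg noeA gW.
have [r hr] : exists r, W n1 `<=` T r n1.
  by apply: (noetherian_uniform noeA (TS n1)) => v [].
have WQ l : W (n1 + r + l)%N `<=` Q (n1 + r + l)%N.
  elim: l => [|l IHl].
    rewrite addn0; apply: (subset_trans (@fg_iter _ _ _ _ hn1 r)).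
    by apply: ideal_mul_min => b v ab /hr; apply.
  rewrite addnS; apply: (subset_trans (@hn1 _ _)); first by lia.
  by apply: ideal_mul_min => b v ab /IHl; exact: QP.
exists (n1 + r)%N => n v len Fv hv; rewrite -(subnKC len); apply: WQ.
rewrite subnKC //; split=> //; exists 1%N => b ab; rewrite addn1.
by apply: hv; rewrite -(@ideal_exp1 A a).
Qed.

(* [x] is superficial for the image of [F] in [A / X], which is the filtration
   by the ideals [idealD (F n) X] modulo [X]. *)
Lemma superficial_exists :
  (forall v, (forall b, a b -> X (b * v)) -> X v) ->
  exists e x, [/\ (0 < e)%N, ideal_exp a e x, forall v, X (x * v) -> X v &
    exists N, forall n v, (N <= n)%N ->
      idealD (F (n + e)%N) X (x * v) -> idealD (F n) X v].
Proof.
move=> hX; have aF b : a b -> F 1%N b by exact: (@sfil_sub _ _ F).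
(* [P1] controls the zero divisors on [A / X], and [P2] below those on the associated graded module
   of [A / X] in degrees at least [n0]; [x] avoids both families. *)
have [q1 [P1 [hP1 hQ1]]] : exists q (P : nat -> nat -> ideal A),
  (forall i, (i < q)%N -> graded_prime a (P i)) /\
  forall n v, (0 <= n)%N -> F n v -> ~ X v -> exists2 i, (i < q)%N &
    forall e b, ideal_exp a e b -> X (b * v) -> P i e b.
  apply: (@associated_primes _ noeA _ F (fun=> X)) => [n b w _|n v _ _].
    exact: ideal_mull.
  exact: hX.
have [n0 hn0] := graded_torsion.
have [q2 [P2 [hP2 hQ2]]] : exists q (P : nat -> nat -> ideal A),
  (forall i, (i < q)%N -> graded_prime a (P i)) /\
  forall n v, (n0 <= n)%N -> F n v -> ~ idealD (F n.+1) X v -> exists2 i, (i < q)%N &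
    forall e b, ideal_exp a e b -> idealD (F (n + e).+1) X (b * v) -> P i e b.
  apply: (@associated_primes _ noeA _ F (fun n => idealD (F n.+1) X)) => //.
  move=> n b w ab [u [Fu Xwu]]; exists (b * u); rewrite -mulrBr; split.
    by apply: (@fil_mulP _ F 1) => //; exact: aF.
  exact: ideal_mull.
pose P i := if (i < q1)%N then P1 i else P2 (i - q1)%N.
have [|e [x [e0 ax xP]]] := @prime_avoidance _ a (q1 + q2) P.
  move=> i lti; rewrite /P; case: ltnP => [/hP1 //|leq]; apply: hP2.
  by rewrite ltn_subLR.
have Xx v : X (x * v) -> X v.
  move=> Xxv; apply: contrapT => Xv.
  have [||i lti Pi] := hQ1 0%N v _ _ Xv => //; first by rewrite fil0.
  apply: (xP i); first exact: ltn_addr.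
  by rewrite /P lti; exact: Pi.
have xstep n v : (n0 <= n)%N -> F n v -> idealD (F (n + e).+1) X (x * v) ->
    idealD (F n.+1) X v.
  move=> len Fv hxv; apply: contrapT => hv.
  have [i lti Pi] := hQ2 n v len Fv hv.
  apply: (xP (q1 + i)%N); first by rewrite ltn_add2l.
  by rewrite /P ltnNge leq_addr addKn; exact: Pi.
exists e, x; split=> //.
(* Artin-Rees for [x]: finite generation of [W] shows that [x * v] in [F (n + e) + X] forces [v]
   into [ideal_exp a (n + e - n1) + X]. From degree [n0] on, [xstep] then raises the degree of [v]
   modulo [X] one at a time. *)
pose W n := idealI (F n) (idealD (principal x) X).
have gW : graded_ideal F W.
  split=> [n w []//|n b w ab [Fw Dw]]; split; last exact: ideal_mull.
  by apply: (@fil_mulP _ F 1) => //; exact: aF.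
have [n1 hn1] := graded_ideal_fg noeA gW.
exists (n0 + n1)%N => n v len hxv.
have [u [Fu Xu]] := hxv.
have le1 : (n1 <= n + e)%N by lia.
have [v' [av' Xv']] : exists v', ideal_exp a (n + e - n1)%N v' /\ X (u - x * v').
  have idV : is_ideal [set w | exists v', ideal_exp a (n + e - n1)%N v' /\ X (w - x * v')].
    split=> [|w w' [v1 [? ?]] [v2 [? ?]]|c w [v1 [? ?]]].
    - by exists 0; rewrite mulr0 subr0; split; exact: ideal_zero.
    - by exists (v1 + v2); rewrite mulrDr opprD addrACA; split; exact: ideal_add.
    - by exists (c * v1); rewrite mulrCA -mulrBr; split; exact: ideal_mull.
  suff : W (n + e)%N `<=` Ideal idV.
    apply; split=> //; exists (x * v); split; first by exists v.
    by rewrite -opprB; exact: ideal_opp.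
  rewrite -{1}(subnKC le1); apply: (subset_trans (@fg_iter _ _ _ _ hn1 _)).
  apply: ideal_mul_min => b w ab [_ [_ [[y _ <-] Xwy]]].
  exists (b * y); rewrite mulrCA -mulrBr; split; last exact: ideal_mull.
  by rewrite mulrC; exact: ideal_mull.
have Xvv' : X (v - v').
  apply: Xx; rewrite mulrBr -[x * v](subrK u) -addrA.
  exact: ideal_add.
have climb k : (n0 + k <= n)%N -> idealD (F (n0 + k)%N) X v.
  elim: k => [|k IHk] lek.
    rewrite addn0; exists v'; split=> //.
    apply: (@fil_decrP _ F n0 (n + e - n1)%N); [by lia|exact: exp_sub_fil].
  have [|v1 [Fv1 Xv1]] := IHk; first by lia.
  suff [w [Fw Xw]] : idealD (F (n0 + k).+1) X v1.
    rewrite addnS; exists w; split=> //.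
    by rewrite -(subrK v1 v) -addrA; exact: ideal_add.
  apply: xstep => //; first exact: leq_addr.
  have -> : x * v1 = x * v - x * (v - v1) by ring.
  apply: ideal_subr; last by apply: idealDr; exact: ideal_mull.
  exists u; split=> //; apply: fil_decrP Fu; lia.
have := climb (n - n0)%N; rewrite subnKC; last by lia.
exact.
Qed.

End Superficial.

(** * Vanishing in degrees of large absolute value *)

Section CechMore.
Variables (R : comNzRingType) (M : lmodType R) (I : Type) (Y : I -> R).
Variables (Q : int -> set M) (QP : graded_family Y Q).

Lemma null_shift j n t f r : null Y Q j n t f ->
  null Y Q j n (t + r) (fun u => cmon Y r u *: f u).
Proof.
move=> [r' [g /(cobounds_shift QP r) hg]].
exists r', (fun u => cmon Y r u *: g u) => s szs.
by have := hg s szs; rewrite cmonD scalerA addnA addnAC.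
Qed.

Lemma null_ideal_subproof j n (e : int) t f :
  is_ideal [set b | null Y Q j (n + e) t (fun u => b *: f u)].
Proof.
have nullZ0 b g : null Y Q j (n + e) t g -> null Y Q j (n + e) t (fun u => b *: g u).
  have := @nullZ _ _ _ _ Q j (n + e) t g b 0; rewrite addr0; apply=> k v.
  by rewrite addr0; exact: (gfamZ QP).
split=> [|b c hb hc|c b hb].
- by apply: null_mem => // s _; rewrite scale0r; exact: (gfam0 QP).
- apply: null_ext (nullB QP hb (nullZ0 (-1) _ hc)) => u _.
  by rewrite scaleN1r opprK scalerDl.
- by apply: null_ext (nullZ0 c _ hb) => u _; rewrite scalerA.
Qed.
Definition null_ideal j n e t f := Ideal (null_ideal_subproof j n e t f).

End CechMore.

(** * Replacing the [Y i] by their powers *)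

Section CechPower.
Variables (R : comNzRingType) (M : lmodType R) (I : Type) (Y : I -> R).
Variables (Q : int -> set M) (QP : graded_family Y Q).
Variables (m : nat) (m_gt0 : (0 < m)%N).

Let Ym i := Y i ^+ m.
Let Qm n := Q (n * m%:Z).

Lemma cdiff_pow t f s : cdiff (M := M) Ym t f s = cdiff Y (m * t) f s.
Proof. by elim: s f => [|i s IHs] f //=; rewrite IHs /Ym exprM. Qed.

Lemma cmon_pow r s : cmon Ym r s = cmon Y (m * r) s.
Proof. by apply: eq_bigr => i _; rewrite /Ym exprM. Qed.

Lemma cocycle_pow j n t f :
  cocycle Ym Qm j n t f <-> cocycle Y Q j (n * m%:Z) (m * t) f.
Proof.
by split=> h s szs; have := h s szs; rewrite cdiff_pow /Qm; congr Q; nia.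
Qed.

Lemma null_pow j n t f :
  null Ym Qm j n t f <-> null Y Q j (n * m%:Z) (m * t) f.
Proof.
split=> [[r [g h]]|[r [g h]]].
  exists (m * r)%N, g => s szs; have := h s szs.
  by rewrite cdiff_pow cmon_pow mulnDr /Qm; congr Q; nia.
exists r, (fun u => cmon Y (m * r - r) u *: g u) => s szs.
have := cobounds_shift QP (m * r - r) h szs.
rewrite cdiff_pow cmon_pow mulnDr subnKC ?leq_pmull // /Qm.
by congr Q; nia.
Qed.

(** Enlarging the exponent [t] to [m * t] turns every denominator into a power of some [Y i ^+ m],
    so both complexes have the same classes. *)
Lemma acyclic_pow j n : acyclic Ym Qm j n <-> acyclic Y Q j (n * m%:Z).
Proof.
split=> h t f.
  move=> hf; apply: (@null_unshift _ _ _ _ _ _ _ _ _ (m * t - t)).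
  have := cocycle_shift QP (m * t - t) hf.
  by rewrite subnKC ?leq_pmull // => /cocycle_pow /h /null_pow.
by move=> /cocycle_pow /h /null_pow.
Qed.

End CechPower.

Section FilteredQuotient.
Variables (A : comNzRingType) (a : ideal A) (F : stable_filtration a).

Definition filz (n : int) : ideal A := if n is Posz k then F k else unit_ideal A.

Lemma filz_le0 (n : int) v : n <= 0 -> filz n v.
Proof. by case: n => [[|k]|k] //= _; rewrite fil0. Qed.

Lemma filz_decr (m n : int) : m <= n -> filz n `<=` filz m.
Proof.
case: m n => [m|m] [n|n] //=; first by rewrite lez_nat; exact: fil_decrP.
Qed.

Lemma filz_mul (n : int) (e : nat) b v :
  ideal_exp a e b -> filz n v -> filz (n + e%:Z) (b * v).
Proof.
case: n => [n|n] ab Fv.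
  by rewrite addrC; apply: fil_mulP => //; exact: exp_sub_fil.
rewrite mulrC; apply: ideal_mull.
by apply: (@filz_decr _ e%:Z); [lia|exact: exp_sub_fil].
Qed.

Variable X : ideal A.

Definition qfam (n : int) : set A^o := idealD (filz n) X.

Lemma qfam_le0 (n : int) v : n <= 0 -> qfam n v.
Proof. by move=> n0; apply: idealDl; exact: filz_le0. Qed.

Lemma qfam_decr (m n : int) : m <= n -> qfam n `<=` qfam m.
Proof. by move=> mn v [u [Fu Xu]]; exists u; split=> //; exact: filz_decr Fu. Qed.

Lemma qfam_mul (n : int) (e : nat) b v :
  ideal_exp a e b -> qfam n v -> qfam (n + e%:Z) (b * v).
Proof.
move=> ab [u [Fu Xu]]; exists (b * u); rewrite -mulrBr; split.
  exact: filz_mul.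
exact: ideal_mull.
Qed.

Lemma qfamP (I : Type) (Y : I -> A) : (forall i, a (Y i)) -> graded_family Y qfam.
Proof.
move=> aY; split=> [n|n v w|n b v|n i v].
- exact: ideal_zero.
- exact: ideal_subr.
- exact: ideal_mull.
- by apply: (@qfam_mul _ 1); rewrite ideal_exp1; exact: aY.
Qed.

End FilteredQuotient.

Definition cfam (A : comNzRingType) (X : ideal A) : int -> set A^o :=
  fun=> ideal_set X.

Lemma cfamP (A : comNzRingType) (X : ideal A) (I : Type) (Y : I -> A) :
  graded_family Y (cfam X).
Proof.
apply: const_family => [|v w|b v].
- exact: ideal_zero.
- exact: ideal_subr.
- exact: ideal_mull.
Qed.

Lemma famx_qfam (A : comNzRingType) (a : ideal A) (F : stable_filtration a) X x :
  famx (qfam F X) x = qfam F (idealD (principal x) X).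
Proof.
apply/funext => n; apply/seteqP; split=> [v [w [u [Fu Xu]]]|v [u [Fu [_ [[w _ <-] Xu]]]]].
- exists u; split=> //; exists (x * w); split; first by exists w.
  by rewrite addrAC.
- by exists w, u; split=> //; rewrite addrAC.
Qed.

Lemma famx_cfam (A : comNzRingType) (X : ideal A) x :
  famx (cfam X) x = cfam (idealD (principal x) X).
Proof.
apply/funext => n; apply/seteqP; split=> [v [w Xw]|v [_ [[w _ <-] Xw]]].
  by exists (x * w); split=> //; exists w.
by exists w.
Qed.

Definition far (N : nat) (n : int) : bool := (n <= - N%:Z) || (N%:Z <= n).

Lemma far_leq N N' n : (N <= N')%N -> far N' n -> far N n.
Proof. rewrite /far; lia. Qed.

Lemma far_shift N (e : nat) n : far (N + e) n -> far N (n + e%:Z) && far N (n - e%:Z).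
Proof. rewrite /far; lia. Qed.

Section SocleFree.
Variables (A : comNzRingType) (noeA : noetherian A) (a : ideal A).
Variables (F : stable_filtration a) (I : Type) (Y : I -> A).
Hypothesis aY : forall i, a (Y i).

(** Weaker than [acyclic]; it is upgraded by torsion in large degrees and by descent from a higher
    degree in very negative ones. *)
Definition socle_free (X : ideal A) (j : nat) (n : int) : Prop :=
  forall t (f : seq I -> A^o), cocycle Y (qfam F X) j n t f ->
    (forall b, a b -> null Y (qfam F X) j (n + 1) t (fun u => b *: f u)) ->
    null Y (qfam F X) j n t f.

Lemma null_exp X j n t (f : seq I -> A^o) e x :
  (forall b, a b -> null Y (qfam F X) j (n + 1) t (fun u => b *: f u)) ->
  (0 < e)%N -> ideal_exp a e x ->
  null Y (qfam F X) j (n + e%:Z) t (fun u => x *: f u).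
Proof.
move=> hf; case: e => // e _; rewrite exp_idealS.
have QP := qfamP F X aY.
suff : ideal_mul a (ideal_exp a e) `<=` null_ideal QP j n e.+1%:Z t f by apply.
apply: ideal_mul_min => b c ab ac.
have hc k v : qfam F X k v -> qfam F X (k + e%:Z) (c *: v) by exact: qfam_mul.
have := nullZ hc (hf b ab).
rewrite -addrA -PoszD add1n; apply: null_ext => u _.
by rewrite scalerA mulrC.
Qed.

Lemma superficial_of_acyclic X : acyclic Y (cfam X) 0 0 ->
  exists e x, [/\ (0 < e)%N, ideal_exp a e x, forall v, X (x * v) -> X v &
    exists N : nat, forall (n : int) v, N%:Z <= n ->
      qfam F X (n + e%:Z) (x * v) -> qfam F X n v].
Proof.
move=> hX; have [|e [x [e0 ax Xx [N hN]]]] := superficial_exists noeA F (X := X).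
  move=> v hv; suff /null0 : null Y (cfam X) 0 0 1 (fun=> v) by [].
  apply: hX => -[|i []] //= _; rewrite subr0 expr1.
  exact: hv.
by exists e, x; split=> //; exists N => -[].
Qed.

(** Induction on [j] modulo a superficial [x]: a class [f] killed by [a t] has [x f = d g], and [g]
    is killed by [a t] modulo [x] in index [j - 1], so [g] bounds there and [f] bounds. For [j = 0],
    [x] is injective in large degrees and the quotient is zero in degrees [n <= 0]. *)
Lemma socle_free_far j X :
  (forall i, (i <= j)%N -> acyclic Y (cfam X) i 0) ->
  (exists N, forall n, far N n -> forall j', (j' < j)%N -> acyclic Y (qfam F X) j' n) ->
  exists N, forall n, far N n -> socle_free X j n.
Proof.
elim: j X => [|j IHj] X hX [N0 hN0].
all: have [e [x [e0 ax Xx [N qinj]]]] := superficial_of_acyclic (hX 0%N isT).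
  exists N.+1 => n /orP[n_neg|n_pos] t f hf haf; apply/null0.
    by apply: qfam_le0; lia.
  apply: qinj; first by lia.
  by have /null0 := null_exp haf e0 ax.
have QP := qfamP F X aY.
have qx n v : qfam F X n v -> qfam F X (n + e%:Z) (x * v) by exact: qfam_mul.
pose X' := idealD (principal x) X.
have hX' i : (i <= j)%N -> acyclic Y (cfam X') i 0.
  move=> leij; rewrite -famx_cfam.
  apply: (@acyclic_famx _ _ _ _ _ (cfamP X Y) x 0 _ 0).
  - by move=> n v; exact: ideal_mull.
  - by move=> n v _; exact: Xx.
  - by apply: hX; exact: leqW.
  - by apply: hX.
have hQ' n : far (N0 + e) n -> forall j', (j' < j)%N -> acyclic Y (qfam F X') j' n.
  move=> nfar j' ltj'; rewrite -famx_qfam; apply: (acyclic_famx QP qx qinj).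
    by apply: hN0; [exact: far_leq (leq_addr _ _) nfar|exact: leqW].
  by apply: hN0 => //; have /andP[] := far_shift nfar.
have [|N1 hN1] := IHj X' hX'; first by exists (N0 + e)%N.
exists (N0 + N1 + e.+1)%N => n nfar t f hf haf.
have [r [g hg]] := null_exp haf e0 ax.
apply: (@null_unshift _ _ _ _ _ _ _ _ _ r).
apply: (null_of_famx QP qinj (g := g)).
  by move=> s szs; have := hg s szs; rewrite !scalerA mulrC.
rewrite famx_qfam; apply: hN1; first by move: nfar; rewrite /far; lia.
  rewrite -famx_qfam => s szs; exists (cmon Y r s *: f s).
  have := gfamN QP (hg s szs).
  by rewrite opprB !scalerA mulrC.
(* With [b f = d h], both [x (d h)] and [b (d g)] equal [x b f], so [b g - x h] is a cocycle. It
   bounds by the vanishing in index [j], whence [b g] bounds modulo [x]. *)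
move=> b ab; have [r' [h hh]] := null_shift QP r (haf b ab).
have g2 : cocycle Y (qfam F X) j (n + e%:Z + 1) (t + r + r')
    (fun u => cmon Y r' u *: (b *: g u) - x *: h u).
  move=> s szs; rewrite cdiffB cdiffZ cdiff_cmon cdiffZ.
  have q1 := qx _ _ (hh s szs).
  have ab1 : ideal_exp a 1 b by rewrite ideal_exp1.
  have q2 := qfam_mul ab1 (gfam_cmon QP r' s (hg s szs)).
  have {q1} q1 : qfam F X (n + e%:Z + 1 + ((t + r + r') * j.+1)%N%:Z)
      (x * (cmon Y r' s *: (cmon Y r s *: (b *: f s)) - cdiff Y (t + r + r') h s)).
    by move: q1; congr (qfam _ _ _ _); lia.
  have {q2} q2 : qfam F X (n + e%:Z + 1 + ((t + r + r') * j.+1)%N%:Z)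
      (b * (cmon Y r' s *: (cmon Y r s *: (x *: f s) - cdiff Y (t + r) g s))).
    by move: q2; rewrite szs; congr (qfam _ _ _ _); lia.
  have := gfamB QP q1 q2; congr (qfam _ _ _ _).
  rewrite /GRing.scale /=; ring.
have [|r2 [w hw]] := hN0 (n + e%:Z + 1) _ j (ltnSn j) _ _ g2.
  by move: nfar; rewrite /far; lia.
exists (r' + r2)%N, w => s szs; rewrite -famx_qfam; exists (cmon Y r2 s *: h s).
have := hw s szs; rewrite !addnA; congr (qfam _ _ _ _).
by rewrite cmonD /GRing.scale /=; ring.
Qed.

Lemma acyclic_down j X n : acyclic Y (qfam F X) j (n + 1) -> socle_free X j n ->
  acyclic Y (qfam F X) j n.
Proof.
move=> hn hs t f hf; apply: hs => // b ab; apply: hn.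
by apply: cocycleZ => // k v; apply: (@qfam_mul _ _ _ _ _ 1); rewrite ideal_exp1.
Qed.

End SocleFree.

Section ClaimT.
Variables (A : comNzRingType) (noeA : noetherian A) (a : ideal A).
Variables (F : stable_filtration a) (ys : seq A).
Hypothesis aE : a = ideal_gen [set x | x \in ys] :> set A.

Let Y (i : nat) : A := ys`_i.

Let aY i : a (Y i).
Proof.
rewrite /Y; have [lti|lei] := ltnP i (size ys); last first.
  by rewrite nth_default //; exact: ideal_zero.
by rewrite aE; apply: sub_gen_smallest; exact: mem_nth.
Qed.

(** Induction on the sum of the [tau i]: multiplying by [Y i] lowers [tau i] by one, so all
    multiples of the class by [a t] vanish, and [socle_free] applies. *)
Lemma torsion_socle_free X j N t :
  (forall n : int, N%:Z <= n -> socle_free F Y X j n) ->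
  forall K (tau : nat -> nat), (\sum_(i < size ys) tau i < K)%N ->
  forall (n : int) (f : seq nat -> A^o), N%:Z <= n -> cocycle Y (qfam F X) j n t f ->
  (forall i, (i < size ys)%N ->
     null Y (qfam F X) j (n + (tau i)%:Z) t (fun u => Y i ^+ tau i *: f u)) ->
  null Y (qfam F X) j n t f.
Proof.
move=> hN; have QP := qfamP F X aY.
elim=> // K IHK tau htau n f len hf hnull.
have [[i [lti ti0]]|hpos] := pselect (exists i, (i < size ys)%N /\ tau i = 0%N).
  have := hnull i lti; rewrite ti0 addr0; apply: null_ext => u _.
  by rewrite expr0 scale1r.
apply: hN => // b; rewrite aE; move: b.
apply: (@ideal_gen_min _ _ (null_ideal QP j n 1 t f)) => y /= /(nthP 0) [i lti <-].
have ti : (0 < tau i)%N by rewrite lt0n; apply/eqP => ti0; apply: hpos; exists i.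
have Y1 k v : qfam F X k v -> qfam F X (k + 1) (Y i *: v) by exact: (gfamY QP).
apply: (IHK (fun l => if l == i then (tau i).-1 else tau l)).
- rewrite (bigD1 (Ordinal lti)) //= eqxx.
  move: htau; rewrite (bigD1 (Ordinal lti)) //= => htau.
  rewrite (eq_bigr (fun l : 'I__ => tau l)); first by lia.
  by move=> l /negPf; rewrite -val_eqE /= => ->.
- by lia.
- exact: cocycleZ.
move=> l ltl; have [->|nli] := eqVneq l i.
  have := hnull i lti; rewrite -addrA -PoszD add1n prednK //.
  by apply: null_ext => u _; rewrite scalerA -exprSr prednK.
have := nullZ Y1 (hnull l ltl); rewrite addrAC; apply: null_ext => u _.
by rewrite !scalerA mulrC.
Qed.

Lemma acyclic_socle_free X j N :
  (forall n : int, N%:Z <= n -> socle_free F Y X j n) ->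
  forall n : int, N%:Z <= n -> acyclic Y (qfam F X) j n.
Proof.
move=> hN n len t f hf.
apply: (torsion_socle_free hN (ltnSn _) (tau := fun=> t)) => // i _.
exact: cocycle_torsion.
Qed.

Lemma acyclic_far X k m : (0 < m)%N ->
  (forall i, (i < k)%N -> acyclic Y (cfam X) i 0) ->
  (forall (n : int) i, (i < k)%N -> acyclic Y (qfam F X) i (n * m%:Z)) ->
  exists N, forall n, far N n -> forall i, (i < k)%N -> acyclic Y (qfam F X) i n.
Proof.
move=> m_gt0 hX hm.
suff : forall j, (j <= k)%N ->
    exists N, forall n, far N n -> forall i, (i < j)%N -> acyclic Y (qfam F X) i n.
  by apply.
elim=> [_|j IHj ltjk]; first by exists 0%N.
have [N hN] := IHj (ltnW ltjk).
have [|N' hN'] := @socle_free_far _ noeA _ F _ _ aY j X _ (ex_intro _ N hN).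
  by move=> i leij; apply: hX; exact: leq_ltn_trans ltjk.
exists (N + N' + m)%N => n nfar i; rewrite ltnS leq_eqVlt => /orP[/eqP ->|lti]; last first.
  by apply: hN => //; move: nfar; rewrite /far; lia.
case/orP: nfar => [n_neg|n_pos]; last first.
  apply: (@acyclic_socle_free X j N'); last by lia.
  by move=> n' n'_pos; apply: hN'; rewrite /far n'_pos orbT.
have down l (n' : int) : n' + l%:Z <= - N'%:Z -> acyclic Y (qfam F X) j (n' + l%:Z) ->
    acyclic Y (qfam F X) j n'.
  elim: l n' => [|l IHl] n'; first by rewrite addr0.
  move=> hl ha; apply: acyclic_down => //.
    apply: IHl; first by lia.
    by move: ha; congr (acyclic _ _ _ _); lia.
  by apply: hN'; rewrite /far; lia.
(* The least multiple of [m] that is at least [n] is less than [m] away; the vanishing there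
   descends to [n]. *)
have [l ltl [c hc]] : exists2 l, (l < m)%N & exists c : int, n + l%:Z = c * m%:Z.
  exists (`|n| %% m)%N; first by rewrite ltn_mod.
  exists (- (`|n| %/ m)%N%:Z); have := divn_eq `|n| m; lia.
apply: (down l); first by lia.
by rewrite hc; exact: hm.
Qed.

End ClaimT.

(** * The associated graded ring *)

Section GradedPieces.
Variables (A : comNzRingType) (G : filtration A).

Lemma gr_eqP (p q : rees G) :
  \pi_(gr G) p = \pi_(gr G) q <-> forall n, G n.+1 ((val p)`_n - (val q)`_n).
Proof.
have -> : (forall n, G n.+1 ((val p)`_n - (val q)`_n)) <-> p - q \in @gr_ker _ G.
  split=> [h|/gr_kerP h n]; first by apply/gr_kerP => n; rewrite rmorphB coefB.
  by have := h n; rewrite rmorphB coefB.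
by rewrite Quotient.idealrBE; split=> /eqP.
Qed.

Definition rees_mono (n : nat) (c : A) : rees G := insubd 0 (c *: 'X^n).

Lemma val_rees_mono n c : G n c -> val (rees_mono n c) = c *: 'X^n.
Proof.
move=> Gc; rewrite /rees_mono val_insubd ifT //.
apply/rees_predP => k; rewrite coefZ coefXn; case: eqP => [->|_].
  by rewrite mulr1.
by rewrite mulr0; exact: ideal_zero.
Qed.

Lemma rees_monoM n m c d : G n c -> G m d ->
  rees_mono (n + m) (c * d) = rees_mono n c * rees_mono m d.
Proof.
move=> Gc Gd; apply: val_inj; rewrite rmorphM /= !val_rees_mono //.
  by rewrite -scalerAl -scalerAr scalerA exprD.
exact: fil_mulP.
Qed.

Lemma rees_monoX n c k : G n c -> rees_mono n c ^+ k = rees_mono (n * k) (c ^+ k).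
Proof.
move=> Gc; elim: k => [|k IHk].
  by apply: val_inj; rewrite muln0 !expr0 val_rees_mono ?fil0 // rmorph1 scale1r.
rewrite !exprS IHk mulnS rees_monoM //; clear IHk.
elim: k => [|k IHk]; first by rewrite muln0 fil0.
by rewrite exprS mulnS; exact: fil_mulP.
Qed.

Lemma rees_monoD n c d : G n c -> G n d ->
  rees_mono n (c + d) = rees_mono n c + rees_mono n d.
Proof.
move=> Gc Gd; apply: val_inj; rewrite rmorphD /= !val_rees_mono //.
  by rewrite scalerDl.
exact: ideal_add.
Qed.

Lemma rees_sum_mono (p : rees G) :
  p = \sum_(i < size (val p)) rees_mono i (val p)`_i.
Proof.
apply: val_inj; rewrite raddf_sum /= -[LHS]coefK poly_def.
by apply: eq_bigr => i _; rewrite val_rees_mono //; exact: reesP.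
Qed.

End GradedPieces.

Section GrCoefficients.
Variables (A : comNzRingType) (b : ideal A) (E : stable_filtration b).

Definition zero_ideal : ideal A := principal 0.

Lemma qfam0E n v : qfam E zero_ideal n v <-> filz E n v.
Proof.
split=> [[u [Eu [w _]]]|Ev]; last exact: idealDl.
by rewrite mul0r => /esym/subr0_eq ->.
Qed.

Local Notation Z := (qfam E zero_ideal).

Definition coefz (p : {poly A}) (n : int) : A := if n is Posz k then p`_k else 0.

(** Depends on the representative chosen by [repr] and is determined modulo [Z (n + 1)], hence the
    congruences below. *)
Definition gcoef (u : gr_mod E) (n : int) : A^o :=
  coefz (val (repr (u : gr E) : rees E)) n.

Lemma gr_scale_pi (p : rees (adic (stable_proper E))) (q : rees E) :
  (\pi_(gr (adic (stable_proper E))) p : gr_adic E) *: (\pi_(gr E) q : gr_mod E) =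
  \pi_(gr E) (rees_incl p * q) :> gr E.
Proof. by rewrite /GRing.scale /= /gr_scale gr_map_pi -rmorphM. Qed.

Lemma gcoef_pi (q : rees E) n : Z (n + 1) (gcoef (\pi_(gr E) q) n - coefz (val q) n).
Proof.
apply/qfam0E; case: n => [n|n]; last by apply: filz_le0; lia.
have -> : n%:Z + 1 = n.+1%:Z by lia.
by move: n; apply/gr_eqP; rewrite reprK.
Qed.

Lemma gcoef_eq0 (u : gr_mod E) : u = 0 <-> forall n, Z (n + 1) (gcoef u n).
Proof.
split=> [->|h].
  move=> n; have := gcoef_pi 0 n.
  have -> : coefz (val (0 : rees E)) n = 0.
    by case: n => // k; rewrite /coefz rmorph0 coef0.
  by rewrite subr0 rmorph0.
rewrite -[u]reprK -[RHS](rmorph0 (\pi_(gr E))); apply/gr_eqP => n.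
have /qfam0E := h n; rewrite rmorph0 coef0 subr0.
by have -> : n%:Z + 1 = n.+1%:Z by lia.
Qed.

Lemma coefzB p q n : coefz (p - q) n = coefz p n - coefz q n.
Proof. by case: n => n; rewrite /coefz ?coefB ?subr0. Qed.

Lemma gcoefB u v n : Z (n + 1) (gcoef (u - v) n - (gcoef u n - gcoef v n)).
Proof.
have := gcoef_pi (repr (u : gr E) - repr (v : gr E)) n.
by rewrite !rmorphB /= !reprK coefzB.
Qed.

Lemma gcoefZ (p : rees (adic (stable_proper E))) c (e : nat) u n :
  val p = c *: 'X^e ->
  Z (n + e%:Z + 1) (gcoef ((\pi_(gr (adic (stable_proper E))) p : gr_adic E) *: u)
                      (n + e%:Z) - c * gcoef u n).
Proof.
move=> pE; rewrite -[u in gcoef (_ *: u)]reprK gr_scale_pi.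
have := gcoef_pi (rees_incl p * repr (u : gr E)) (n + e%:Z).
congr (Z _ (_ - _)); rewrite rmorphM /= -/(val p) pE -scalerAl /gcoef.
case: n => [n|n].
  by rewrite -PoszD /= coefZ coefXnM ltnNge leq_addl addnK.
rewrite /= mulr0; case E1 : (Negz n + e%:Z) => [k|//] /=.
rewrite coefZ coefXnM ifT ?mulr0 //; lia.
Qed.

Variables (I : Type) (Y : I -> A).
Hypothesis bY : forall i, b (Y i).

Definition gY (i : I) : gr_adic E :=
  \pi_(gr (adic (stable_proper E))) (rees_mono (adic (stable_proper E)) 1 (Y i)).

Let ZP : graded_family Y Z := qfamP E zero_ideal bY.

Lemma gcoefYX i (t : nat) u n :
  Z (n + t%:Z + 1) (gcoef (gY i ^+ t *: u) (n + t%:Z) - Y i ^+ t * gcoef u n).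
Proof.
have b1 : adic (stable_proper E) 1%N (Y i) by rewrite /= ideal_exp1.
rewrite /gY -rmorphXn; apply: gcoefZ.
by rewrite rmorphXn /= -/(val _) val_rees_mono // exprZn expr1.
Qed.

Lemma gcoef_cdiff (t : nat) (g : seq I -> gr_mod E) s n :
  Z (n + t%:Z + 1) (gcoef (cdiff gY t g s) (n + t%:Z) -
    cdiff Y t (fun u => gcoef (g u) n) s).
Proof.
elim: s g => [|i s IHs] g /=.
  by rewrite subr0; apply: (gcoef_eq0 0).1.
have h1 := gcoefB (gY i ^+ t *: g s) (cdiff gY t (fun u => g (i :: u)) s) (n + t%:Z).
have h2 := gcoefYX i t (g s) n.
have := gfamB ZP (gfamD ZP h1 h2) (IHs (fun u => g (i :: u))).
by congr (Z _ _); rewrite /GRing.scale /=; ring.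
Qed.

Lemma gcoef_cmon (r : nat) u s n :
  Z (n + (r * size s)%N%:Z + 1)
    (gcoef (cmon gY r s *: u) (n + (r * size s)%N%:Z) - cmon Y r s * gcoef u n).
Proof.
elim: s => [|i s IHs] /=.
  rewrite muln0 addr0 /cmon !big_nil scale1r mul1r subrr; exact: (gfam0 ZP).
rewrite !cmon_cons -scalerA.
have h1 := gcoefYX i r (cmon gY r s *: u) (n + (r * size s)%N%:Z).
have h2 := gfamYX ZP r i IHs.
have {h1} h1 : Z (n + (r * (size s).+1)%N%:Z + 1)
    (gcoef (gY i ^+ r *: (cmon gY r s *: u)) (n + (r * (size s).+1)%N%:Z) -
     Y i ^+ r * gcoef (cmon gY r s *: u) (n + (r * size s)%N%:Z)).
  have -> : n + (r * (size s).+1)%N%:Z = n + (r * size s)%N%:Z + r%:Z by lia.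
  exact: h1.
have {h2} h2 : Z (n + (r * (size s).+1)%N%:Z + 1)
    (Y i ^+ r *: (gcoef (cmon gY r s *: u) (n + (r * size s)%N%:Z) -
                  cmon Y r s * gcoef u n)).
  by move: h2; congr (Z _ _); lia.
have := gfamD ZP h1 h2; congr (Z _ _).
by rewrite /GRing.scale /=; ring.
Qed.

(** From [0 -> G_n -> L_(n+1) -> L_n -> 0]: a cocycle of [L_(n+1)] that bounds in [L_n] differs from
    a coboundary by a cocycle [phi] of [G], which bounds by hypothesis. *)
Lemma null_gr_climb j n t f : acyclic gY (fun=> [set 0 : gr_mod E]) j 0 ->
  cocycle Y Z j (n + 1) t f -> null Y Z j n t f -> null Y Z j (n + 1) t f.
Proof.
move=> acy hf [r [g hg]].
have [n_le0|n_gt0] := lerP (n + ((t + r) * j)%N%:Z + 1) 0.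
  exists r, g => s szs; apply: qfam_le0; lia.
case nE : (n + ((t + r) * j)%N%:Z) => [N|N]; last by lia.
pose T := (t + r)%N.
pose f' s := cmon Y r s *: f s - cdiff Y T g s.
have f'E s : size s = j -> E N (f' s).
  by move=> szs; have /qfam0E := hg s szs; rewrite nE.
pose phi s : gr_mod E := if size s == j then \pi_(gr E) (rees_mono E N (f' s)) else 0.
have phiE s k : size s = j ->
    Z (k + 1) (gcoef (phi s) k - (if k == N%:Z then f' s else 0)).
  move=> szs; rewrite /phi szs eqxx.
  have := gcoef_pi (rees_mono E N (f' s)) k; congr (Z _ (_ - _)).
  rewrite val_rees_mono; last exact: f'E.
  case: k => k //=; rewrite coefZ coefXn eqz_nat.
  by case: eqP; rewrite ?mulr1 ?mulr0.
have cphi : cocycle gY (fun=> [set 0 : gr_mod E]) j 0 T phi.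
  move=> s szs; apply/gcoef_eq0 => k.
  have -> : k = (k - T%:Z) + T%:Z by lia.
  move: (k - T%:Z) => {}k.
  have h1 := gcoef_cdiff T phi s k.
  have := gfam_cdiff ZP T (fun u szu => phiE u k szu) szs.
  rewrite cdiffB => h2.
  have h3 : Z (k + T%:Z + 1) (cdiff Y T (fun u => if k == N%:Z then f' u else 0) s).
    case: eqP => [->|_]; last first.
      rewrite (_ : cdiff _ _ _ _ = 0); first exact: (gfam0 ZP).
      have -> : (fun=> 0 : A^o) = (fun u => 0 *: f' u) by apply/funext => u; rewrite scale0r.
      by rewrite cdiffZ scale0r.
    rewrite cdiffB cdiff_cmon cdiffK subr0.
    have := gfam_cmon ZP r s (hf s szs); rewrite szs; congr (Z _ _); rewrite /T; lia.
  have {}h2 : Z (k + T%:Z + 1) (cdiff Y T (fun u => gcoef (phi u) k) s -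
     cdiff Y T (fun u => if k == N%:Z then f' u else 0) s).
    by move: h2; congr (Z _ _); lia.
  have := gfamD ZP (gfamD ZP h1 h2) h3; congr (Z _ _).
  by rewrite addrA !subrK.
have [r' [gam hgam]] := acy _ _ cphi.
(* As [cdiff] with exponent [T + r'] raises degrees by [T + r'], the coefficient of [gam] is taken
   that far below the numerator degree. *)
exists (r + r')%N, (fun u => cmon Y r' u *: g u +
  gcoef (gam u) (n + ((T + r') * j)%N%:Z - (T + r')%N%:Z)) => s szs.
set T' := (T + r')%N; set D := n + ((T + r') * j)%N%:Z.
have h0 := (gcoef_eq0 _).1 (hgam s szs) D.
have h1 := gcoefB (cmon gY r' s *: phi s) (cdiff gY T' gam s) D.
have h2 := gcoef_cmon r' (phi s) s N%:Z.
have h3 := gfam_cmon ZP r' s (phiE s N%:Z szs).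
have h4 := gcoef_cdiff T' gam s (D - T'%:Z).
have ND : N%:Z + (r' * size s)%N%:Z = D by rewrite /D szs; lia.
rewrite subrK in h4; rewrite ND in h2; rewrite addrAC ND eqxx in h3.
move: h0 h1 h2 h3 h4.
move: (gcoef (_ - _) D) (gcoef (_ *: _) D) (gcoef (cdiff _ _ _ _) D) (gcoef (phi s) N%:Z).
move=> w p1 p2 p3 h0 h1 h2 h3 h4.
have := gfamB ZP (gfamD ZP (gfamB ZP (gfamB ZP h0 h1) h2) h4) h3.
rewrite cdiffD (_ : (t + (r + r') = T + r')%N) ?addnA // cdiff_cmon.
rewrite /f' cmonD /D; congr (Z _ _); first by lia.
by rewrite -/T' /GRing.scale /=; ring.
Qed.

Lemma acyclic_of_gr k :
  (forall j, (j < k)%N -> acyclic gY (fun=> [set 0 : gr_mod E]) j 0) ->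
  forall j, (j < k)%N -> forall n, acyclic Y Z j n.
Proof.
move=> acy j ltj n t f hf.
(* At [l = 0] the numerators have degree [n] minus its absolute value, where [Z] is everything; the
   bound on [l] keeps the degree at most [n], so that [f] stays a cocycle. *)
suff climb l : (l%:Z <= `|n|%N%:Z + (t * j)%N%:Z) ->
    null Y Z j (n - `|n|%N%:Z - (t * j)%N%:Z + l%:Z) t f.
  have := climb (`|n| + t * j)%N; rewrite PoszD lexx => /(_ isT).
  by congr (null _ _ _ _ _ _); lia.
elim: l => [|l IHl] hl.
  apply: null_mem => s _; apply: qfam_le0; lia.
rewrite -addn1 PoszD addrA; apply: null_gr_climb; first exact: acy.
  move=> s szs; apply: qfam_decr (hf s szs); lia.
by apply: IHl; lia.
Qed.

End GrCoefficients.

(** * Superficial sequences and their initial forms *)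

Section SuperficialSequence.
Variables (A : comNzRingType) (noeA : noetherian A) (b : ideal A).
Variables (E : stable_filtration b).

Implicit Types X K : ideal A.

(** Injectivity on [\bigoplus A / (E n + X)] is demanded in every degree, not only in large ones;
    this makes the initial forms a regular sequence. *)
Fixpoint supseq (X : ideal A) (xs : seq (nat * A)) : Prop :=
  if xs is ex :: s then
    [/\ (0 < ex.1)%N, ideal_exp b ex.1 ex.2, forall v, X (ex.2 * v) -> X v &
        forall (n : int) v, qfam E X (n + ex.1%:Z) (ex.2 * v) -> qfam E X n v] /\
    supseq (idealD (principal ex.2) X) s
  else True.

Fixpoint supend (X : ideal A) (xs : seq (nat * A)) : ideal A :=
  if xs is ex :: s then supend (idealD (principal ex.2) X) s else X.

Lemma supseq_exists (I : Type) (Y : I -> A) (bY : forall i, b (Y i)) k k' X :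
  (k <= k')%N -> (forall j, (j < k')%N -> forall n, acyclic Y (qfam E X) j n) ->
  (forall j, (j < k)%N -> acyclic Y (cfam X) j 0) ->
  exists xs, [/\ size xs = k, supseq X xs &
    forall j, (j < k' - k)%N -> forall n, acyclic Y (qfam E (supend X xs)) j n].
Proof.
elim: k k' X => [|k IHk] k' X lek hq hc.
  by exists [::]; split=> //; rewrite subn0.
have [e [x [e0 bx Xx [N qinj]]]] := superficial_of_acyclic noeA E bY (hc 0%N isT).
have QP := qfamP E X bY.
have qx n v : qfam E X n v -> qfam E X (n + e%:Z) (x * v) by exact: qfam_mul.
(* Multiplying by [Y i ^+ t] moves [v] into degrees where [x] is injective, so [v] is killed by
   [Y i ^+ t] and vanishes by acyclicity in index 0. *)
have xinj (n : int) v : qfam E X (n + e%:Z) (x * v) -> qfam E X n v.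
  move=> hv; pose t := (`|N| + `|n|)%N.
  suff /null0 : null Y (qfam E X) 0 n t (fun=> v : A^o) by [].
  apply: hq => [|[|i []] //= _]; first exact: leq_trans lek.
  rewrite subr0; apply: qinj; first by rewrite /t; lia.
  have := gfamYX QP t i hv; congr (qfam _ _ _ _); first by lia.
  by rewrite /GRing.scale /=; ring.
case: k' lek hq => // k' lek hq.
have [j ltj n|j ltj|xs [szxs hxs axs]] := IHk k' (idealD (principal x) X) lek.
- rewrite -famx_qfam; apply: (acyclic_famx QP qx qinj); apply: hq => //.
  exact: ltnW.
- rewrite -famx_cfam; apply: (@acyclic_famx _ _ _ _ _ (cfamP X Y) x 0 _ 0).
  + by move=> n v; exact: ideal_mull.
  + by move=> n v _; exact: Xx.
  + by apply: hc; exact: ltnW.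
  + by apply: hc.
by exists ((e, x) :: xs); split; rewrite /= ?szxs.
Qed.

Lemma supseq_mem X xs ex : supseq X xs -> ex \in xs ->
  (0 < ex.1)%N /\ ideal_exp b ex.1 ex.2.
Proof.
elim: xs X => // ex' xs IHxs X [[e0 bx _ _] hxs].
by rewrite inE => /orP[/eqP -> //|]; exact: IHxs hxs.
Qed.

(** Applied with [K = E 1], which is proper, to see that quotients by superficial sequences are
    nonzero. *)
Lemma supend_sub X xs (K : ideal A) : X `<=` K -> b `<=` K -> supseq X xs ->
  supend X xs `<=` K.
Proof.
move=> XK bK; elim: xs X XK => // -[e x] xs IHxs X XK /= [[e0 bx _ _] hxs].
apply: IHxs hxs => v [_ [[y _ <-] Xv]].
rewrite -(subrK (x * y) v); apply: ideal_add; first exact: XK.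
rewrite mulrC; apply: ideal_mull; apply: bK.
exact: ideal_exp_sub bx.
Qed.

(* [regular] is the first conjunct of [regular_seq] *)
Definition regular (R : comNzRingType) (M : lmodType R) (s : seq R) : Prop :=
  forall i : nat, (i < size s)%N -> forall u : M,
     seq_mul (take i s) (s`_i *: u) -> seq_mul (take i s) u.

Lemma regular_rcons (R : comNzRingType) (M : lmodType R) (s : seq R) x :
  regular M s -> (forall u : M, seq_mul s (x *: u) -> seq_mul s u) ->
  regular M (rcons s x).
Proof.
move=> hs hx i; rewrite size_rcons ltnS leq_eqVlt => /orP[/eqP ->|lti] u.
  by rewrite -cats1 take_size_cat // nth_cat ltnn subnn; exact: hx.
by rewrite -cats1 takel_cat ?(ltnW lti) // nth_cat lti; exact: hs.
Qed.

Lemma regular_supseq X xs (pre : seq A) :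
  supseq X xs -> seq_mul pre = (X : set A^o) -> regular A^o pre ->
  regular A^o (pre ++ map snd xs) /\
  seq_mul (pre ++ map snd xs) = (supend X xs : set A^o).
Proof.
elim: xs X pre => [|[e x] xs IHxs] X pre /=; first by rewrite cats0.
move=> [[_ _ Xx _] hxs] hpre rpre; rewrite -cat_rcons.
apply: IHxs => //.
  by rewrite seq_mul_rcons hpre; exact: (congr1 (@^~ 0) (famx_cfam X x)).
by apply: regular_rcons => // u; rewrite hpre; exact: Xx.
Qed.

Definition gr_mono (e : nat) (x : A) : gr_adic E :=
  \pi_(gr (adic (stable_proper E))) (rees_mono (adic (stable_proper E)) e x).

(** [pre] collects the initial forms already treated. By the invariant, dividing [gr E] by them
    gives the associated graded module of the image of [E] in [A / X]; regularity of the next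
    initial form is then the injectivity in [supseq]. *)
Lemma regular_gr_supseq X xs (pre : seq (gr_adic E)) :
  supseq X xs ->
  (forall p : rees E, @seq_mul _ (gr_mod E) pre (\pi_(gr E) p) <->
     forall n : nat, qfam E X n.+1%:Z (val p)`_n) ->
  regular (gr_mod E) pre ->
  regular (gr_mod E) (pre ++ [seq gr_mono ex.1 ex.2 | ex <- xs]) /\
  (forall p : rees E,
     @seq_mul _ (gr_mod E) (pre ++ [seq gr_mono ex.1 ex.2 | ex <- xs]) (\pi_(gr E) p) <->
     forall n : nat, qfam E (supend X xs) n.+1%:Z (val p)`_n).
Proof.
elim: xs X pre => [|[e x] xs IHxs] X pre /=; first by rewrite cats0.
move=> [[e0 bx Xx xinj] hxs] hpre rpre; rewrite -cat_rcons.
have ax : adic (stable_proper E) e x by [].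
have scaleE (q : rees E) : gr_mono e x *: (\pi_(gr E) q : gr_mod E) =
    \pi_(gr E) (rees_incl (rees_mono (adic (stable_proper E)) e x) * q) :> gr E.
  exact: gr_scale_pi.
have valE (q : rees E) : val (rees_incl (rees_mono (adic (stable_proper E)) e x) * q) =
    x *: ('X^e * val q).
  by rewrite rmorphM /= -/(val _) val_rees_mono // -scalerAl.
apply: IHxs => //; last first.
  apply: regular_rcons => // u; rewrite -[u]reprK scaleE => /hpre h.
  apply/hpre => n; apply: xinj.
  have := h (n + e)%N; rewrite valE coefZ coefXnM ltnNge leq_addl addnK.
  by congr (qfam _ _ _ _); lia.
have subE (p q : rees E) :
    (\pi_(gr E) p : gr_mod E) - gr_mono e x *: (\pi_(gr E) q : gr_mod E) =
    \pi_(gr E) (p - rees_incl (rees_mono (adic (stable_proper E)) e x) * q).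
  by rewrite scaleE; exact: esym (rmorphB _ _ _).
have coefE (p q : rees E) n :
    (val (p - rees_incl (rees_mono (adic (stable_proper E)) e x) * q))`_n =
    (val p)`_n - x * (if (n < e)%N then 0 else (val q)`_(n - e)).
  have -> (q' : rees E) : val (p - q') = val p - val q' by rewrite rmorphB.
  by rewrite coefB valE coefZ coefXnM.
move=> p; rewrite seq_mul_rcons -famx_qfam; split.
  move=> [w]; rewrite -[w]reprK subE => /hpre h n.
  have := h n; rewrite coefE => hn.
  by exists (if (n < e)%N then 0 else (val (repr w))`_(n - e)).
move=> /choice [w hw].
(* Injectivity of [x] allows [w (n + e)] to be replaced by an element of [E n], so that the
   multiplier comes from the Rees algebra. *)
have /choice [v hv] n : exists v, E n v /\ X (x * (w (n + e)%N - v)).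
  have [v [Ev Xwv]] : qfam E X n%:Z (w (n + e)%N).
    apply: xinj; have := hw (n + e)%N => /(@qfam_decr _ _ E X (n + e)%N%:Z _ _) h.
    have -> : x * w (n + e)%N = (val p)`_(n + e) - ((val p)`_(n + e) - x * w (n + e)%N) by ring.
    apply: ideal_subr; last by apply: h; lia.
    by apply: idealDl; exact: reesP.
  by exists v; split=> //; exact: ideal_mull.
have qE : \poly_(k < size (val p)) v k \in rees_pred E.
  apply/rees_predP => k; rewrite coef_poly; case: ifP => _.
    by have [] := hv k.
  exact: ideal_zero.
exists (\pi_(gr E) (Rees qE)); rewrite subE; apply/hpre => n; rewrite coefE /=.
(* Below degree [e] there is no correction term, but [x] lies in [E e], hence in [E n.+1]. *)
have [ltne|lene] := ltnP n e.
  rewrite mulr0 subr0 -(subrK (x * w n) (val p)`_n).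
  apply: ideal_add; first exact: hw.
  apply: idealDl; rewrite mulrC; apply: ideal_mull.
  by apply: (@fil_decrP _ E _ e); [lia|exact: exp_sub_fil].
rewrite coef_poly; case: ltnP => [lts|ges]; last first.
  rewrite mulr0 subr0 nth_default; first exact: ideal_zero.
  by apply: leq_trans ges _; exact: leq_subr.
have [_] := hv (n - e)%N; rewrite subnK // => Xwv.
have -> : (rees_val p)`_n - x * v (n - e)%N =
  ((val p)`_n - x * w n) + x * (w n - v (n - e)%N) by rewrite /=; ring.
by apply: ideal_add; [exact: hw|exact: idealDr].
Qed.

End SuperficialSequence.

(** * The homogeneous maximal ideal up to radical *)

Section HomogeneousMaximalIdeal.
Variables (A : comNzRingType) (a : ideal A) (m : nat) (m_gt0 : (0 < m)%N).
Variables (E : stable_filtration (ideal_exp a m)) (ys : seq A).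
Hypothesis aE : a = ideal_gen [set x | x \in ys] :> set A.

Local Notation b := (ideal_exp a m).
Local Notation mono := (@gr_mono A b E).
Local Notation BE := (adic (stable_proper E)).

Lemma gr_monoM n k c d : ideal_exp b n c -> ideal_exp b k d ->
  mono (n + k) (c * d) = mono n c * mono k d.
Proof. by move=> bc bd; rewrite /gr_mono (@rees_monoM _ BE) // rmorphM. Qed.

Lemma gr_monoD n c d : ideal_exp b n c -> ideal_exp b n d ->
  mono n (c + d) = mono n c + mono n d.
Proof. by move=> bc bd; rewrite /gr_mono (@rees_monoD _ BE) // rmorphD. Qed.

Lemma gr_monoX n k c : ideal_exp b n c -> mono n c ^+ k = mono (n * k) (c ^+ k).
Proof. by move=> bc; rewrite /gr_mono -rmorphXn (@rees_monoX _ BE). Qed.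

Lemma exp_exp_sub l n c : ideal_exp a (n * l) c -> ideal_exp (ideal_exp a l) n c.
Proof.
elim: n c => [//|n IHn] c; rewrite mulSn => hc.
suff : ideal_exp a (l + n * l) `<=` ideal_mul (ideal_exp a l) (ideal_exp a (n * l)).
  by move=> /(_ c hc); apply: ideal_mul_mono => d /IHn.
move: (n * l)%N => k {hc IHn c}.
elim: l => [|l IHl] c hc; first by rewrite -[c]mul1r; exact: mem_ideal_mul.
move: c hc; rewrite addSn exp_idealS; apply: ideal_mul_min => u v au /IHl.
apply: ideal_mul_ind => s t as_ at_; rewrite mulrA.
by apply: mem_ideal_mul => //; exact: mem_ideal_mul.
Qed.

Variable T : set (gr_adic E).
Hypothesis TP : radical_set T.
Hypothesis TY : forall i, T (mono 1 (ys`_i ^+ m)).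

Let T0 : T 0.
Proof. by rewrite -(mul0r (mono 1 (ys`_0 ^+ m))); apply: (rad_mul TP). Qed.

Let ysa i : a ys`_i.
Proof.
have [lti|lei] := ltnP i (size ys); last by rewrite nth_default //; exact: ideal_zero.
by rewrite aE; apply: sub_gen_smallest; exact: mem_nth.
Qed.

Lemma rad_mono_ideal n :
  is_ideal [set c | ideal_exp b n c /\ T (mono n c)].
Proof.
split=> [|c d [bc Tc] [bd Td]|s c [bc Tc]].
- split; first exact: ideal_zero.
  by rewrite /gr_mono (_ : rees_mono _ _ _ = 0) ?rmorph0 //; apply: val_inj;
    rewrite val_rees_mono ?scale0r ?rmorph0 //; exact: ideal_zero.
- split; first exact: ideal_add.
  by rewrite gr_monoD //; exact: (rad_add TP).
- split; first exact: ideal_mull.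
  by rewrite -[n]add0n gr_monoM //; exact: (rad_mul TP).
Qed.

Lemma rad_mono1 c : b c -> T (mono 1 c).
Proof.
have hb1 u : b u -> ideal_exp b 1 u by rewrite ideal_exp1.
have idy : is_ideal [set y | a y /\ forall c, ideal_exp a m.-1 c -> T (mono 1 (y * c))].
  have prod y c' : a y -> ideal_exp a m.-1 c' -> ideal_exp b 1 (y * c').
    by move=> ay ac'; apply: hb1; rewrite -(prednK m_gt0); exact: mem_ideal_mul.
  split=> [|y z [ay hy] [az hz]|s y [ay hy]].
  - split=> [|c' ac']; first exact: ideal_zero.
    by rewrite mul0r; case: (rad_mono_ideal 1) => -[].
  - split=> [|c' ac']; first exact: ideal_add.
    rewrite mulrDl gr_monoD; [|exact: prod..].
    by apply: (rad_add TP); auto.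
  - split=> [|c' ac']; first exact: ideal_mull.
    rewrite -mulrA -[1%N]add0n gr_monoM //; last exact: prod.
    by apply: (rad_mul TP); exact: hy.
have ay y : a y -> forall c, ideal_exp a m.-1 c -> T (mono 1 (y * c)).
  suff : a `<=` Ideal idy by move=> h /h [].
  rewrite {1}aE; apply: ideal_gen_min => x /= /(nthP 0) [i _ <-].
  (* the [m]-th power of [(y c') t] is [(y ^ m t) (c' ^ m t ^ (m - 1))] *)
  split=> // c' ac'; apply: (rad_root TP (N := m)).
  rewrite gr_monoX; last by apply: hb1; rewrite -(prednK m_gt0); exact: mem_ideal_mul.
  have mE : (1 + m.-1 = m)%N by rewrite add1n prednK.
  rewrite exprMn mul1n -[X in gr_mono E X _]mE gr_monoM.
  - by rewrite mulrC; apply: (rad_mul TP).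
  - by apply: hb1; rewrite -[X in ideal_exp a X]muln1; apply: ideal_exp_pow; rewrite ideal_exp1.
  - by apply: exp_exp_sub; rewrite mulnC; exact: ideal_exp_pow.
have : b `<=` Ideal (rad_mono_ideal 1); last by move=> h /h [].
have bE : b = ideal_mul a (ideal_exp a m.-1) by rewrite -[in LHS](prednK m_gt0).
rewrite {1}bE; apply: ideal_mul_min => y c' hy ac'; split; last exact: ay.
by apply: hb1; rewrite bE; exact: mem_ideal_mul.
Qed.

(** Monomials of positive degree are sums of products of monomials of degree 1. In degree 0 an
    element of [mm] has a power in [ideal_exp a m], which is zero in [gr_adic E]. *)
Lemma gr_max_sub_radical (mm : ideal A) : radical a = mm ->
  gr_max BE mm `<=` T.
Proof.
move=> amm _ [p pmm <-].
have monoT n c : ideal_exp b n.+1 c -> T (mono n.+1 c).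
  elim: n c => [|n IHn] c; first by rewrite ideal_exp1; exact: rad_mono1.
  suff : ideal_exp b n.+2 `<=` Ideal (rad_mono_ideal n.+2) by move=> h /h [].
  apply: (@ideal_mul_min _ b (ideal_exp b n.+1)) => u v bu bv.
  split; first exact: mem_ideal_mul.
  rewrite -[n.+2]add1n gr_monoM ?ideal_exp1 //.
  by apply: (rad_mul TP); exact: IHn.
rewrite (rees_sum_mono p) rmorph_sum /=; apply: big_ind => //; first exact: (rad_add TP).
move=> [[|i] lti] _ /=; last by apply: monoT; exact: (@reesP _ BE p i.+1).
have powm x : a x -> ideal_exp a m (x ^+ m).
  by have := @ideal_exp_pow _ a 1 x m; rewrite muln1 ideal_exp1.
have : radical a (val p)`_0 by rewrite amm.
move=> [N aN]; apply: (rad_root TP (N := N * m)).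
have /= -> := @gr_monoX 0 (N * m) (rees_val p)`_0 I.
rewrite mul0n (_ : mono 0 _ = 0) //.
rewrite /gr_mono -(rmorph0 (\pi_(gr BE))); apply/gr_eqP => k.
rewrite val_rees_mono // rmorph0 coef0 subr0 coefZ coefXn.
case: k => [|k]; last by rewrite mulr0; exact: ideal_zero.
rewrite mulr1 /= ideal_exp1 exprM.
exact: powm.
Qed.

End HomogeneousMaximalIdeal.

(** * Depth of [A], saturation, and Veronese filtrations *)

Lemma cfam_zero (A : comNzRingType) (i : int) :
  cfam (zero_ideal A) i = @seq_mul A A^o [::].
Proof.
rewrite seq_mul_nil; apply/seteqP; split=> [_ [y _ <-]|_ ->] /=.
  by rewrite mul0r.
by exists 0; rewrite // mul0r.
Qed.

(** Elements of [mm] have powers in [a], so they lie in every radical set containing the generators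
    of [a]. *)
Lemma acyclic_of_depth (A : comNzRingType) (mm a : ideal A) (ys : seq A) (x : seq A) :
  a = ideal_gen [set x | x \in ys] :> set A -> radical a = mm ->
  {in x, forall c, mm c} -> regular A^o x ->
  forall j, (j < size x)%N -> acyclic (fun i => ys`_i) (cfam (zero_ideal A)) j 0.
Proof.
move=> aE amm xmm xreg j ltj.
have -> : cfam (zero_ideal A) = fun=> @seq_mul A A^o (take 0 x).
  by apply/funext => i; rewrite take0 cfam_zero.
apply: regular_acyclic xreg _ _ _ => // c /xmm; rewrite -amm => -[N aN] T TP TY.
have idT : is_ideal T.
  split=> [||]; [|exact: (rad_add TP)|exact: (rad_mul TP)].
  by rewrite -(mul0r ys`_0); apply: (rad_mul TP).
apply: (rad_root TP (N := N)); move: aN; rewrite aE.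
apply: (@ideal_gen_min _ _ (Ideal idT)) => y /= /(nthP 0) [i _ <-].
exact: TY.
Qed.

(** An element [v] killed by [b] modulo [X] is a cocycle of index 0 in every degree, so it agrees
    modulo [X] with an element of [E n1.+1], again killed by [b]. By finite generation such elements
    lie in [b] times elements killed by [b], that is, in [X]. *)
Lemma saturated_of_acyclic (A : comNzRingType) (noeA : noetherian A) (b : ideal A)
    (E : stable_filtration b) (I : Type) (Y : I -> A) (X : ideal A) :
  (forall i, b (Y i)) -> (forall n, acyclic Y (qfam E X) 0 n) ->
  forall v, (forall c, b c -> X (c * v)) -> X v.
Proof.
move=> bY acy v bv.
have idT : is_ideal [set u | forall c, b c -> X (c * u)].
  split=> [c _|u w hu hw c bc|d u hu c bc]; first by rewrite mulr0; exact: ideal_zero.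
    by rewrite mulrDr; apply: ideal_add; auto.
  by rewrite mulrCA; apply: ideal_mull; exact: hu.
pose W n := idealI (E n) (Ideal idT).
have gW : graded_ideal E W.
  split=> [n w []//|n c w bc [Ew Tw]]; split; last exact: ideal_mull.
  by apply: (@fil_mulP _ E 1) => //; exact: (@sfil_sub _ _ E).
have [n1 hn1] := graded_ideal_fg noeA gW.
have WX : W n1.+1 `<=` X.
  apply: subset_trans (hn1 n1 (leqnn _)) _.
  by apply: ideal_mul_min => c w bc [_]; apply.
suff [u [Eu Xvu]] : qfam E X n1.+1%:Z v.
  rewrite -(subrK u v); apply: ideal_add => //; apply: WX; split=> // c bc.
  have -> : c * u = c * v - c * (v - u) by ring.
  by apply: ideal_subr; [exact: bv|exact: ideal_mull].
suff /null0 : null Y (qfam E X) 0 n1.+1%:Z 1 (fun=> v : A^o) by [].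
apply: acy => -[|i []] //= _; rewrite subr0 expr1; apply: idealDr; exact: bv.
Qed.

Section VeroneseFamily.
Variables (A : comNzRingType) (a : ideal A) (F : stable_filtration a).
Variables (m : nat) (m_gt0 : (0 < m)%N).

Lemma qfam_veronese X n : qfam (veronese F m_gt0) X n = qfam F X (n * m%:Z).
Proof.
have fE : filz (veronese F m_gt0) n = filz F (n * m%:Z) :> set A.
  case: n => [n|n]; first by rewrite -PoszM.
  apply/seteqP; split=> v _; first by apply: filz_le0; nia.
  by apply: filz_le0.
by apply/seteqP; split=> v [u [Fu Xu]]; exists u; split=> //; move: Fu; rewrite fE.
Qed.

Lemma acyclic_veronese (I : Type) (Y : I -> A) X j n : (forall i, a (Y i)) ->
  acyclic (fun i => Y i ^+ m) (qfam (veronese F m_gt0) X) j n <->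
  acyclic Y (qfam F X) j (n * m%:Z).
Proof.
move=> aY; rewrite -(acyclic_pow (qfamP F X aY) m_gt0).
have -> : qfam (veronese F m_gt0) X = fun n => qfam F X (n * m%:Z) => //.
by apply/funext => k; rewrite qfam_veronese.
Qed.

End VeroneseFamily.

Theorem theorem1p5 (A : comNzRingType) (mm a : ideal A)
    (hA : cohen_macaulay_local mm) (ha : primary_to mm a)
    (F : stable_filtration a) :
  exists d m0 : nat, forall (m : nat) (m_gt0 : (0 < m)%N),
    (m0 <= m)%N -> has_gr_depth mm (veronese F m_gt0) d.
Proof.
have [noeA _ [d [_ [[x [xmm [xreg _] szx]] depth_max]]]] := hA.
have [_ amm] := ha.
have [ys aE] := noeA a.
pose Y i := ys`_i.
have aY i : a (Y i).
  have [lti|lei] := ltnP i (size ys); last by rewrite /Y nth_default //; exact: ideal_zero.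
  by rewrite aE; apply: sub_gen_smallest; exact: mem_nth.
have acyA j : (j < d)%N -> acyclic Y (cfam (zero_ideal A)) j 0.
  by rewrite -szx; apply: (acyclic_of_depth aE amm xmm xreg).
(* The vanishing attached to depth at least [k] for the [m]-th Veronese filtration, read off from
   [F] in degrees divisible by [m]. *)
pose good m k := forall j, (j < k)%N -> forall n, acyclic Y (qfam F (zero_ideal A)) j (n * m%:Z).
pose P k := `[< (k <= d)%N /\ exists2 m, (0 < m)%N & good m k >].
have [k /asboolP [lekd [m1 m1_gt0 good1]] kmax] : {k | P k & forall k', P k' -> (k' <= k)%N}.
  have P0 : exists k, P k by exists 0%N; apply/asboolP; split=> //; exists 1%N.
  have Pd k : P k -> (k <= d)%N by move=> /asboolP [].
  by case: (ex_maxnP P0 Pd) => k Pk hk; exists k.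
have [N hN] : exists N, forall n, far N n -> forall i, (i < k)%N ->
    acyclic Y (qfam F (zero_ideal A)) i n.
  apply: (acyclic_far noeA aE m1_gt0) => [i lti|n i lti].
    by apply: acyA; exact: leq_trans lekd.
  exact: good1.
(* For [m > N] every nonzero multiple of [m] is far; degree 0 occurs in all Veronese filtrations and
   is covered by [m1]. *)
exists k, N.+1 => m m_gt0 leNm.
have goodm : good m k.
  move=> j ltj n; have [->|n0] := eqVneq n 0.
    by have := good1 j ltj 0; rewrite !mul0r.
  by apply: hN => //; rewrite /far; nia.
pose E := veronese F m_gt0; pose Ym i := Y i ^+ m.
have bYm i : ideal_exp a m (Ym i).
  by have := @ideal_exp_pow _ a 1 (Y i) m; rewrite muln1 ideal_exp1; apply.
have acyE j k' : good m k' -> (j < k')%N -> forall n, acyclic Ym (qfam E (zero_ideal A)) j n.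
  by move=> gk ltj n; apply/acyclic_veronese => //; exact: gk.
have acyAm j : (j < d)%N -> acyclic Ym (cfam (zero_ideal A)) j 0.
  move=> ltj; have := acyclic_pow (cfamP (zero_ideal A) Y) m_gt0 j 0.
  by move=> [_]; apply; rewrite mul0r; exact: acyA.
have bE1 : ideal_exp a m `<=` E 1%N by exact: (@sfil_sub _ _ E).
have zeroE1 : zero_ideal A `<=` E 1%N.
  by move=> _ [y _ <-]; rewrite mul0r; exact: ideal_zero.
split.
  have [xs [szxs hxs _]] := supseq_exists noeA bYm (leqnn k) (fun j => acyE j k goodm)
    (fun j ltj => acyAm j (leq_trans ltj lekd)).
  have [| |reg regE] := @regular_gr_supseq _ _ E (zero_ideal A) xs [::] hxs.
  - move=> p; rewrite seq_mul_nil -(rmorph0 (\pi_(gr E))).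
    have zP : (\pi_(gr E) p = \pi_(gr E) 0) <-> forall n : nat, qfam E (zero_ideal A) n.+1%:Z (val p)`_n.
      rewrite gr_eqP; split=> h n.
        by apply/qfam0E; have := h n; rewrite rmorph0 coef0 subr0.
      by have /qfam0E := h n; rewrite rmorph0 coef0 subr0.
    exact: zP.
  - by move=> i; rewrite ltn0.
  exists [seq gr_mono E ex.1 ex.2 | ex <- xs]; split; last by rewrite size_map.
  - move=> _ /mapP [[e c] hec ->] /=; have [/= e0 bc] := supseq_mem hxs hec.
    exists (rees_mono (adic (stable_proper E)) e c) => //=.
    have /= -> := @val_rees_mono _ (adic (stable_proper E)) e c bc.
    by rewrite coefZ coefXn; case: e e0 {hec bc} => // e _; rewrite mulr0; exact: ideal_zero.
  - split; first exact: reg.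
    move=> eqT; have : @seq_mul _ (gr_mod E) [seq gr_mono E ex.1 ex.2 | ex <- xs] (\pi_(gr E) 1).
      by rewrite eqT.
    move=> /regE /(_ 0%N); rewrite rmorph1 coef1 => -[u [Eu Xu]].
    apply: (@fil1N1 _ E); rewrite -(subrK u 1); apply: ideal_add => //.
    exact: (supend_sub zeroE1 bE1 hxs) Xu.
move=> z zmax [zreg _]; rewrite leqNgt; apply/negP => ltkz.
(* A regular sequence longer than [k] gives vanishing in one more index for this [m]; by maximality
   of [k] this forces [k = d]. *)
have acyz j : (j < k.+1)%N -> forall n, acyclic Ym (qfam E (zero_ideal A)) j n.
  apply: acyclic_of_gr => // {}j ltj.
  rewrite -(seq_mul_nil (gr_mod E)) -(take0 z).
  apply: regular_acyclic zreg _ _ _; last exact: leq_trans ltj ltkz.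
  move=> c cz T TP TY; apply: (gr_max_sub_radical m_gt0 aE TP _ amm) => //.
  exact: zmax.
have goodm1 : good m k.+1.
  by move=> j ltj n; apply/acyclic_veronese => //; exact: acyz.
have kd : k = d.
  apply/eqP; rewrite eqn_leq lekd leqNgt; apply/negP => ltkd.
  have /kmax : P k.+1 by apply/asboolP; split=> //; exists m.
  by rewrite ltnn.
(* Spending [d] of the [d + 1] vanishing indices on a superficial sequence leaves index 0 modulo it,
   hence saturation and a further superficial element [c]: a regular sequence of length [d + 1] in
   [A]. *)
have [xs [szxs hxs axs]] := supseq_exists noeA bYm (leqnSn k) acyz
  (fun j ltj => acyAm j (leq_trans ltj lekd)).
have sat := saturated_of_acyclic noeA bYm (axs 0%N _).
rewrite subSnn in sat; have {}sat := sat isT.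
have [e [c [e0 bc Xc _]]] := superficial_exists noeA E sat.
have [rxs sxs] := @regular_supseq _ _ E (zero_ideal A) xs [::] hxs
  (esym (cfam_zero A 0)) (fun i => fun h : (i < 0)%N => False_ind _ (notF h)).
have bmm l u : (0 < l)%N -> ideal_exp (ideal_exp a m) l u -> mm u.
  move=> l_gt0 /(ideal_exp_sub l_gt0) /(ideal_exp_sub m_gt0) au.
  by rewrite -amm; exists 1%N; rewrite expr1.
suff : (size (rcons (map snd xs) c) <= d)%N.
  by rewrite size_rcons size_map szxs kd ltnn.
apply: depth_max.
  move=> u; rewrite mem_rcons inE => /orP[/eqP ->|/mapP [ex hex ->]]; first exact: bmm bc.
  by have [ex0 bex] := supseq_mem hxs hex; exact: bmm bex.
split.
  by apply: regular_rcons => // u; rewrite sxs; exact: Xc.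
move=> eqT; have : @seq_mul A A^o (rcons (map snd xs) c) 1 by rewrite eqT.
rewrite seq_mul_rcons sxs => -[w X1].
apply: (@fil1N1 _ E); rewrite -(subrK (c * w) 1); apply: ideal_add.
  exact: (supend_sub zeroE1 bE1 hxs) X1.
rewrite mulrC; apply: ideal_mull; apply: bE1; exact: ideal_exp_sub bc.
Qed.
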